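(* For every integer $n\ge 1$, the number of feasible score sequences $R$ of length $n$ with the property that $|U_{\min}(R)|=1$ is $$c_1\left(\frac{1-\sqrt{2\sqrt{5}+3}}2\right)^{n-1}+c_2\left(\frac{1+\sqrt{2\sqrt{5}+3}}2\right)^{n-1}+c_3\left(\frac{1-i\sqrt{2\sqrt{5}-3}}2\right)^{n-1}+c_4\left(\frac{1+i\sqrt{2\sqrt{5}-3}}2\right)^{n-1},$$ where $i=\sqrt{-1}$ is the imaginary unit and $$c_1=\frac{\sqrt{5}+1}4\left(\frac{1}{\sqrt{5}}-\frac{1}{\sqrt{2\sqrt{5}+3}}\right),\qquad c_2=\frac{\sqrt{5}+1}4\left(\frac{1}{\sqrt{5}}+\frac{1}{\sqrt{2\sqrt{5}+3}}\right),$$ $$c_3=\frac{\sqrt{5}-1}4\left(\frac{1}{\sqrt{5}}-\frac{i}{\sqrt{2\sqrt{5}-3}}\right),\qquad c_4=\frac{\sqrt{5}-1}4\left(\frac{1}{\sqrt{5}}+\frac{i}{\sqrt{2\sqrt{5}-3}}\right).$$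
   Context: A tournament matrix of order $n$ is an $n\times n$ $(0,1)$-matrix $A=(a_{ij})$ with $A+A^{T}=J-I$, where $J$ is the all-ones matrix and $I$ the identity matrix (i.e. the adjacency matrix of an orientation of the complete graph on the ordered vertex set $\{1,\ldots,n\}$). Its score sequence is its row sum vector. A feasible score sequence of length $n$ is a nondecreasing integer vector $R=(r_1,\ldots,r_n)$ with $\sum_{i=1}^n r_i=\binom n2$ and $\sum_{i=1}^k r_i\ge\binom k2$ for $k=1,\ldots,n-1$. Let $\mathcal T(R)$ be the set of all $n\times n$ tournament matrices whose row sum vector is exactly $R$ (row $i$ has sum $r_i$). An upset of a tournament matrix $A=(a_{ij})$ is an entry $a_{ij}=1$ with $i<j$. $U_{\min}(R)$ denotes the set of all matrices in $\mathcal T(R)$ whose number of upsets is minimum among all matrices in $\mathcal T(R)$. *)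

(* Defs.v *)
From mathcomp Require Import all_boot all_order all_algebra.

Set Implicit Arguments.
Unset Strict Implicit.
Unset Printing Implicit Defensive.

Import Order.TTheory GRing.Theory Num.Theory.

Local Open Scope ring_scope.

(* Vertices {1, ..., n} are 'I_n = {0, ..., n-1} in the same order.
   A (0,1)-matrix is a boolean matrix; it is read in the integers for the
   matrix equation A + A^T = J - I and for its row sums. *)
Definition int_mx (n : nat) (A : 'M[bool]_n) : 'M[int]_n :=
  map_mx (fun b : bool => (b : nat)%:Z) A.

Definition tournament_mx (n : nat) (A : 'M[bool]_n) : bool :=
  int_mx A + (int_mx A)^T == const_mx 1 - 1%:M.

Definition row_sums (n : nat) (A : 'M[bool]_n) : 'rV[int]_n :=
  \row_i \sum_j int_mx A i j.

Definition feasible (n : nat) (R : 'rV[int]_n) : Prop :=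
  [/\ forall i j : 'I_n, (i <= j)%N -> R 0 i <= R 0 j,
      \sum_(i < n) R 0 i = 'C(n, 2)%:Z
    & forall k : nat, (1 <= k <= n.-1)%N ->
        'C(k, 2)%:Z <= \sum_(i < n | (i < k)%N) R 0 i].

Definition tournaments (n : nat) (R : 'rV[int]_n) : {set 'M[bool]_n} :=
  [set A | tournament_mx A & row_sums A == R].

Definition upsets (n : nat) (A : 'M[bool]_n) : nat :=
  #|[set p : 'I_n * 'I_n | A p.1 p.2 & (p.1 < p.2)%N]|.

Definition Umin (n : nat) (R : 'rV[int]_n) : {set 'M[bool]_n} :=
  [set A in tournaments R |
     [forall B in tournaments R, (upsets A <= upsets B)%N]].

(* The set of elements satisfying P is finite, with exactly m elements. *)
Definition has_card (T : eqType) (P : T -> Prop) (m : nat) : Prop :=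
  exists s : seq T, [/\ uniq s, forall x, x \in s <-> P x & size s = m].

(* Main.v *)
(** Put [D i = r_i - (i - 1)], the number of upsets leaving vertex [i] minus the number of
    upsets entering it.  [U_min(R)] is a singleton exactly when [D] is a concatenation of
    blocks [k, k-1, ..., 1, 0, ..., 0, -1, ..., -k] with [m >= 1] zeros (and [m = 1] when
    [k = 0]).

    If the minimiser [A] is unique, reversing a directed 3- or 4-cycle must strictly increase
    the number of upsets, so such cycles contain at most one upset.  Hence no two upsets are
    consecutive, every vertex is a source, a sink or neutral, and upsets [a -> y], [e -> f]
    admit no exchange.  Since [R] is nondecreasing, [D] decreases by at most one per step;
    this discrete continuity produces sources and sinks of every intermediate degree, and
    counting them forces the block shape.  Conversely, for a concatenation of blocks there is a
    potential [phi] such that [phi i - phi j] exceeds 1 if [i -> j] is an upset of the block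
    tournament and is less than 1 for the other pairs [i < j]; as the scores are fixed, this
    dual certificate makes the block tournament the unique minimiser.

    Counting sequences of blocks of lengths [2k + m] gives
    [a_(n+4) = 2 a_(n+3) - a_(n+1) + a_n] with initial values 1, 1, 2, 4.  The characteristic
    polynomial is [(x^2 - x)^2 - (x^2 - x) - 1], so [x^2 - x = (1 +- sqrt 5) / 2]. *)

Require Import Defs.
From mathcomp Require Import all_boot all_order all_algebra.
From mathcomp Require Import zify ring lra.

Set Implicit Arguments.
Unset Strict Implicit.
Unset Printing Implicit Defensive.

Import Order.TTheory GRing.Theory Num.Theory.

Local Open Scope ring_scope.

(** * Counting indices below n *)

Definition cnt (n : nat) (P : pred nat) : nat := #|[set i : 'I_n | P i]|.

Section Cnt.
Variable n : nat.
Implicit Types (P Q : pred nat) (f : nat -> nat).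

Lemma cnt_le P Q : (forall i, (i < n)%N -> P i -> Q i) -> (cnt n P <= cnt n Q)%N.
Proof.
by move=> PQ; apply/subset_leq_card/subsetP => i; rewrite !inE; apply: PQ.
Qed.

Lemma eq_cnt P Q : (forall i, (i < n)%N -> P i = Q i) -> cnt n P = cnt n Q.
Proof. by move=> PQ; apply: eq_card => i; rewrite !inE PQ. Qed.

Lemma cnt_gt0P P : reflect (exists2 i, (i < n)%N & P i) (0 < cnt n P)%N.
Proof.
apply: (iffP card_gt0P) => [[i]|[i iltn Pi]].
  by rewrite inE => Pi; exists i.
by exists (Ordinal iltn); rewrite inE.
Qed.

Lemma cntD1 P j : (j < n)%N -> P j -> cnt n P = (cnt n (fun i => (i != j) && P i)).+1.
Proof.
move=> jn Pj; rewrite /cnt (cardsD1 (Ordinal jn)) inE /= Pj.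
by congr (_.+1); apply: eq_card => i; rewrite !inE.
Qed.

Lemma cnt1_inj P i j : cnt n P = 1%N -> (i < n)%N -> (j < n)%N -> P i -> P j -> i = j.
Proof.
move=> P1 iltn jltn Pi Pj; apply/eqP/negPn/negP => ij.
have : (0 < cnt n (fun h => (h != j) && P h))%N.
  by apply/cnt_gt0P; exists i; rewrite ?ij.
by have := cntD1 jltn Pj; lia.
Qed.

Lemma cnt_sub_eq P Q : (forall i, (i < n)%N -> P i -> Q i) -> (cnt n Q <= cnt n P)%N ->
  forall i, (i < n)%N -> Q i -> P i.
Proof.
move=> PQ QP i iltn Qi; apply/negPn/negP => nPi.
have : (cnt n P <= cnt n (fun h => (h != i) && Q h))%N.
  apply: cnt_le => h hn Ph; rewrite PQ // andbT; apply: contraNneq nPi => <- //.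
by have := cntD1 iltn Qi; lia.
Qed.

Lemma cnt_surj P f k :
    (forall v, (0 < v <= k)%N -> exists i, [/\ (i < n)%N, P i & f i = v]) ->
  (k <= cnt n P)%N.
Proof.
elim: k P => // k IH P surj.
have [|j [jn Pj fj]] := surj k.+1; first by rewrite ltnS leqnn.
rewrite (cntD1 jn Pj) ltnS; apply: IH => v vk.
have [|i [iltn Pi fi]] := surj v; first lia.
by exists i; split=> //; rewrite Pi andbT; apply/eqP => ij; subst j; lia.
Qed.

(** Pigeonhole: if [f i = f j] with [i != j], then [P] without [j] still attains all [k] values, so
    [P] has more than [k] elements. *)
Lemma cnt_surj_inj P f k :
    (forall v, (0 < v <= k)%N -> exists i, [/\ (i < n)%N, P i & f i = v]) ->
    (cnt n P <= k)%N ->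
  forall i j, (i < n)%N -> (j < n)%N -> P i -> P j -> f i = f j -> i = j.
Proof.
move=> surj Pk i j iltn jn Pi Pj fij; apply/eqP/negPn/negP => ij.
have : (k <= cnt n (fun h => (h != j) && P h))%N.
  apply: (@cnt_surj _ f) => v vk; have [h [hn Ph fh]] := surj v vk.
  case: (eqVneq h j) => [hj|hj]; last by exists h; rewrite hj.
  by exists i; split; rewrite ?ij //; rewrite fij -hj.
by have := cntD1 jn Pj; lia.
Qed.

Lemma cnt_split Q P :
  cnt n P = (cnt n (fun i => P i && Q i) + cnt n (fun i => P i && ~~ Q i))%N.
Proof.
rewrite /cnt -(cardsID [set i : 'I_n | Q i]).
by congr addn; apply: eq_card => i; rewrite !inE // andbC.
Qed.

Lemma cnt_ltn i : (i <= n)%N -> cnt n (fun j => (j < i)%N) = i.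
Proof.
elim: i => [|i IH] hi; first by apply/eqP; rewrite -leqn0 leqNgt; apply/cnt_gt0P => -[].
rewrite (@cntD1 _ i) //; congr _.+1.
by rewrite -[RHS]IH 1?ltnW //; apply: eq_cnt => j _; lia.
Qed.

End Cnt.

(** Discrete continuity: [f] may jump up by any amount but descends by at most one per step, so it
    skips no value on the way down. *)
Lemma descent_ivt (f : nat -> int) (a b : nat) (v : int) :
  (a <= b)%N -> (forall i, (a <= i < b)%N -> f i - 1 <= f i.+1) ->
  f b <= v <= f a -> exists2 i, (a <= i <= b)%N & f i = v.
Proof.
move=> ab; have [m mE] : exists m, m = (b - a)%N by exists (b - a)%N.
elim: m a ab mE => [|m IH] a ab mE drop fv.
  by exists a; [lia|have ab' : a = b by lia]; rewrite -ab' in fv; lia.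
have [fa|fa] := eqVneq (f a) v; first by exists a => //; lia.
have ab1 : (a < b)%N by lia.
have dropa : f a - 1 <= f a.+1 by apply: drop; lia.
have [| | | |i ih iv] := IH a.+1; try lia.
- by move=> i ih; apply: drop; lia.
by exists i => //; lia.
Qed.

Lemma cnt_interval n a b : (b <= n)%N -> cnt n (fun j => (a <= j < b)%N) = (b - a)%N.
Proof.
move=> bn; have [ab|/ltnW ba] := leqP a b.
  have := cnt_split n (fun j => (j < a)%N) (fun j => (j < b)%N).
  have -> : cnt n (fun j => (j < b)%N && (j < a)%N) = a.
    rewrite -[RHS](@cnt_ltn n a); last exact: leq_trans bn.
    by apply: eq_cnt => j _; lia.
  have -> : cnt n (fun j => (j < b)%N && ~~ (j < a)%N) = cnt n (fun j => (a <= j < b)%N).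
    by apply: eq_cnt => j _; lia.
  by rewrite cnt_ltn //; lia.
have -> : (b - a = 0)%N by lia.
by apply/eqP; rewrite -leqn0 leqNgt; apply/cnt_gt0P => -[j _]; lia.
Qed.

Lemma cntE n (P : pred nat) : cnt n P = (\sum_(i < n) P i)%N.
Proof. by rewrite /cnt -sum1dep_card big_mkcond; apply: eq_bigr => i _; case: (P i). Qed.

Lemma cnt_add a b (P : pred nat) : cnt (a + b) P = (cnt a P + cnt b (fun i => P (a + i)%N))%N.
Proof. by rewrite !cntE big_split_ord. Qed.

Lemma cnt_pred0 n (P : pred nat) : (forall i, (i < n)%N -> P i = false) -> cnt n P = 0%N.
Proof.
move=> P0; apply/eqP; rewrite -leqn0 leqNgt; apply/cnt_gt0P => -[i /P0 ->] //.
Qed.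

(** * Concatenations of blocks *)

(* The pair [(k, m)] stands for the block [k, ..., 1, 0, ..., 0, -1, ..., -k] with [m] zeros. *)
Definition bsize (b : nat * nat) : nat := 2 * b.1 + b.2.
Definition valid (b : nat * nat) : bool := (0 < b.2)%N && ((b.1 == 0%N) ==> (b.2 == 1%N)).
Definition btotal (bs : seq (nat * nat)) : nat := sumn (map bsize bs).

Fixpoint bexcess (bs : seq (nat * nat)) (i : nat) : int :=
  if bs isn't (k, m) :: bs' then 0
  else if (i < k)%N then k%:Z - i%:Z
  else if (i < k + m)%N then 0
  else if (i < 2 * k + m)%N then - (i - (k + m)).+1%:Z
  else bexcess bs' (i - (2 * k + m)).

(* In a block starting at 0, source [i] beats sink [k + m + j] exactly when [i <= j]. *)
Fixpoint bup (bs : seq (nat * nat)) (i j : nat) : bool :=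
  if bs isn't (k, m) :: bs' then false
  else if (i < 2 * k + m)%N then (i + (k + m) <= j < 2 * k + m)%N
  else bup bs' (i - (2 * k + m)) (j - (2 * k + m)).

(* Linear inside a block, with a slope such that a drop of 1 falls strictly between the
   distances [k + m - 1] and [k + m]; the shift by 2 keeps different blocks from interacting. *)
Fixpoint bpot (bs : seq (nat * nat)) (i : nat) : rat :=
  if bs isn't (k, m) :: bs' then 0
  else if (i < 2 * k + m)%N then - (i%:R / ((k + m)%:R - 2^-1))
  else bpot bs' (i - (2 * k + m)) + 2.

Lemma bup_lt bs i j : all valid bs -> bup bs i j -> (i < j < btotal bs)%N.
Proof.
elim: bs i j => //= -[k m] bs IH i j /andP[vb vbs].
have m0 : (0 < m)%N by case/andP: vb.
rewrite /btotal /= -/(btotal bs) /bsize /=.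
case: ltnP => [il|il]; first lia.
by move/(IH _ _ vbs); lia.
Qed.

(** Within a block, source [i] has [k - i] targets and sink [k + m + j] has [j + 1] origins; upsets
    never join different blocks. *)
Lemma bexcessE bs i : all valid bs -> (i < btotal bs)%N ->
  (cnt (btotal bs) (bup bs i))%:Z - (cnt (btotal bs) ((bup bs)^~ i))%:Z = bexcess bs i.
Proof.
elim: bs i => // -[k m] bs IH i vbbs.
have /andP[vb vbs] : valid (k, m) && all valid bs := vbbs.
have m0 : (0 < m)%N by case/andP: vb.
have -> : btotal ((k, m) :: bs) = (2 * k + m + btotal bs)%N by [].
move=> hi; rewrite [RHS]/= !(cnt_add (2 * k + m)).
set L := (2 * k + m)%N; have [iL|Li] := ltnP i L.
  (* Truncated subtraction: this is [k - i] for the sources and 0 from [k] on. *)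
  have -> : cnt L (bup ((k, m) :: bs) i) = (L - (i + (k + m)))%N.
    rewrite -(@cnt_interval L) //; apply: eq_cnt => j _ /=.
    by rewrite iL.
  have -> : cnt (btotal bs) (fun h => bup ((k, m) :: bs) i (L + h)) = 0%N.
    by apply: cnt_pred0 => h _ /=; rewrite iL; lia.
  have -> : cnt L (fun j => bup ((k, m) :: bs) j i) = (i.+1 - (k + m))%N.
    rewrite -[RHS]subn0 -(@cnt_interval L); last by lia.
    by apply: eq_cnt => j /= jL; rewrite jL; lia.
  have -> : cnt (btotal bs) (fun h => bup ((k, m) :: bs) (L + h) i) = 0%N.
    apply: cnt_pred0 => h _ /=; rewrite ltnNge leq_addr /=.
    by apply/negP => /(bup_lt vbs); lia.
  rewrite /L in iL *; case: ltnP => ik; [|case: ltnP => ikm]; lia.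
have -> : cnt L (bup ((k, m) :: bs) i) = 0%N.
  apply: cnt_pred0 => h hL /=; rewrite ltnNge Li /=.
  by apply/negP => /(bup_lt vbs); lia.
have -> : cnt L (fun j => bup ((k, m) :: bs) j i) = 0%N.
  by apply: cnt_pred0 => h hL /=; rewrite hL; lia.
have -> : cnt (btotal bs) (fun h => bup ((k, m) :: bs) i (L + h)) = cnt (btotal bs) (bup bs (i - L)).
  by apply: eq_cnt => h _ /=; rewrite ltnNge Li /= addKn.
have -> : cnt (btotal bs) (fun h => bup ((k, m) :: bs) (L + h) i) =
    cnt (btotal bs) ((bup bs)^~ (i - L)%N).
  by apply: eq_cnt => h _ /=; rewrite ltnNge leq_addr /= addKn.
rewrite !add0n IH //; last by lia.
by rewrite /L in Li *; do 2 (case: ltnP; first lia).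
Qed.

(** Since [m > 0], drops inside a block are at most one, and the next block starts at a value >= 0.
    This makes the scores nondecreasing. *)
Lemma bexcess_drop bs i : all valid bs -> (i.+1 < btotal bs)%N -> bexcess bs i - 1 <= bexcess bs i.+1.
Proof.
have first_ge0 cs : 0 <= bexcess cs 0.
  elim: cs => //= -[k m] cs IH; rewrite sub0n.
  case: (ltnP 0 k) => k0; first by lia.
  by case: (ltnP 0 (k + m)) => // km0; have -> : (0 < 2 * k + m)%N = false by lia.
elim: bs i => //= -[k m] bs IH i /andP[vb vbs].
rewrite /btotal /= -/(btotal bs) /bsize /= => hi.
have m0 : (0 < m)%N by case/andP: vb.
case: (ltnP i (2 * k + m)) => [iL|Li].
  have [iL'|Li'] := ltnP i.+1 (2 * k + m); first by repeat (case: ltnP => ?; try lia).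
  have -> : (i.+1 - (2 * k + m) = 0)%N by lia.
  have := first_ge0 bs; repeat (case: ltnP => ?; try lia).
have -> : (i < k)%N = false by lia.
have -> : (i < k + m)%N = false by lia.
have -> : (i.+1 < k)%N = false by lia.
have -> : (i.+1 < k + m)%N = false by lia.
have -> : (i.+1 < 2 * k + m)%N = false by lia.
by rewrite subSn //; apply: IH => //; lia.
Qed.

(** The last index [2k + m - 1] of a block is less than twice [k + m - 1/2] because [m > 0]. Hence
    the shift by 2 makes the potential positive on all later blocks, while it is nonpositive on the
    first. *)
Lemma bpot_bounds bs i : all valid bs -> (i < btotal bs)%N -> -2 < bpot bs i.
Proof.
elim: bs i => //= -[k m] bs IH i /andP[vb vbs].
rewrite /btotal /= -/(btotal bs) /bsize /= => hi.
have m0 : (0 < m)%N by case/andP: vb.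
case: ltnP => [iL|Li]; last by have := IH (i - (2 * k + m))%N vbs ltac:(lia); lra.
have km : 1 <= (k + m)%:R :> rat by rewrite ler1n; lia.
have ikm : i%:R + 2 <= 2 * (k + m)%:R :> rat.
  by rewrite -natrM -natrD ler_nat; lia.
by rewrite ltrN2 ltr_pdivrMr; lra.
Qed.

(** The dual certificate. Inside a block the gap is [(j - i) / (k + m - 1/2)], which exceeds 1
    exactly when [j - i >= k + m]; from one block to a later one it is negative. *)
Lemma bpot_gap bs i j : all valid bs -> (i < j < btotal bs)%N ->
  if bup bs i j then 1 < bpot bs i - bpot bs j else bpot bs i - bpot bs j < 1.
Proof.
elim: bs i j => [|[k m] bs IH] i j /=; first by rewrite ltn0 andbF.
case/andP=> vb vbs.
rewrite /btotal /= -/(btotal bs) /bsize /= => hij.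
have m0 : (0 < m)%N by case/andP: vb.
have km : 1 <= (k + m)%:R :> rat by rewrite ler1n; lia.
have c0 : 0 < (k + m)%:R - 2^-1 :> rat by lra.
case: ltnP => [iL|Li]; last first.
  have -> : (j < 2 * k + m)%N = false by lia.
  have := IH (i - (2 * k + m))%N (j - (2 * k + m))%N vbs ltac:(lia).
  by case: bup; lra.
case: ltnP => [jL|Lj].
  rewrite opprK addrC -mulrBl andbT.
  case: leqP => ij.
    rewrite ltr_pdivlMr // mul1r.
    have : i%:R + (k + m)%:R <= j%:R :> rat by rewrite -natrD ler_nat.
    lra.
  rewrite ltr_pdivrMr // mul1r.
  have : j%:R + 1 <= i%:R + (k + m)%:R :> rat by rewrite -!natrD natr1 ler_nat.
  lra.
rewrite andbF.
have := @bpot_bounds bs (j - (2 * k + m)) vbs ltac:(lia).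
have : 0 <= i%:R / ((k + m)%:R - 2^-1) :> rat by rewrite divr_ge0 // ltW.
lra.
Qed.

(** The value at 0 is [k]. If [k > 0] and the zero runs differ, then just after the shorter one the
    values are -1 and 0; if [k = 0], validity forces [m = 1]. *)
Lemma bexcess_inj bs bs' : all valid bs -> all valid bs' -> btotal bs = btotal bs' ->
  (forall i, (i < btotal bs)%N -> bexcess bs i = bexcess bs' i) -> bs = bs'.
Proof.
elim: bs bs' => [|[k m] bs IH] [|[k' m'] bs'] //=.
- by move=> _ /andP[/andP[/= ? _] _]; rewrite /btotal /= /bsize /=; lia.
- by move=> /andP[/andP[/= ? _] _] _; rewrite /btotal /= /bsize /=; lia.
case/andP=> /andP[/= m0 v] vbs /andP[/andP[/= m0' v'] vbs'].
rewrite /btotal /= -/(btotal bs) -/(btotal bs') /bsize /= => tE H.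
have kk' : k = k'.
  have := H 0%N ltac:(lia).
  by repeat (case: ltnP => ?; try lia).
subst k'.
have mm' : m = m'.
  case: (posnP k) => k0; first by move: v v'; rewrite k0 /=; do 2 move/eqP->.
  have [||//] := ltngtP m m' => mm.
    have := H (k + m)%N ltac:(lia).
    by repeat (case: ltnP => ?; try lia).
  have := H (k + m')%N ltac:(lia).
  by repeat (case: ltnP => ?; try lia).
subst m'; congr cons; apply: IH => //; first by lia.
move=> i hi; have := H (2 * k + m + i)%N ltac:(lia).
by repeat (case: ltnP => ?; try lia); rewrite addKn.
Qed.

(** * Tournaments whose short cycles have at most one upset *)

Section Structure.
Variables (n : nat) (t : rel nat).
Hypothesis t_dom : forall i j, t i j -> (i < n)%N && (j < n)%N.
Hypothesis t_tour : forall i j, (i < n)%N -> (j < n)%N -> i != j -> t i j = ~~ t j i.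
Hypothesis t_irr : forall i, t i i = false.
Hypothesis cycle3 : forall a b c, t a b -> t b c -> t c a ->
  ((a < b) + (b < c) + (c < a) <= 1)%N.
Hypothesis cycle4 : forall a b c d, t a b -> t b c -> t c d -> t d a ->
  ((a < b) + (b < c) + (c < d) + (d < a) <= 1)%N.
Hypothesis score_mono : forall i j, (i <= j)%N -> (j < n)%N -> (cnt n (t i) <= cnt n (t j))%N.

Let up i j := (i < j)%N && t i j.
Let outd i := cnt n (up i).
Let ind j := cnt n (up^~ j).
Definition excess i : int := (outd i)%:Z - (ind i)%:Z.
Local Notation D := excess.

Lemma t_asym i j : t i j -> t j i = false.
Proof.
move=> tij; have /andP[hi hj] := t_dom tij.
have [ij|ij] := eqVneq i j; first by rewrite ij t_irr.
by apply/negbTE; rewrite -t_tour.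
Qed.

Lemma t_back i j : (i < n)%N -> (j < n)%N -> (i < j)%N -> ~~ up i j -> t j i.
Proof.
move=> hi hj ij; rewrite /up ij /= => nt; rewrite t_tour //; lia.
Qed.

Lemma up_dom i j : up i j -> [/\ (i < n)%N, (j < n)%N & (i < j)%N].
Proof. by case/andP=> ij /t_dom/andP[]. Qed.

(** The triangle condition forces [k] to beat [j]. As [j] scores at least as much as [k], some [w]
    satisfies [t j w] and [t w k], which closes a 4-cycle with two upsets. *)
Lemma no_up_path k i j : up k i -> up i j -> False.
Proof.
move=> upki upij.
have [hk hi ki] := up_dom upki; have [_ hj ij] := up_dom upij.
case/andP: (upki) (upij) => _ tki /andP[_ tij].
have tkj : t k j.
  by rewrite t_tour; [apply/negP => tjk; have := cycle3 tki tij tjk; lia|lia..].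
have kj : (k <= j)%N by lia.
have [w tjw twk] : exists2 w, t j w & t w k.
  have /cnt_gt0P[w hw] : (0 < cnt n (fun w => t j w && t w k))%N; last first.
    by case/andP=> *; exists w.
  rewrite lt0n; apply/negP => /eqP c0.
  (* Without such a [w], all vertices beaten by [j] are beaten by [k], and the scores force
     equality; but [k] beats [j], which does not beat itself. *)
  have jk : forall w, (w < n)%N -> t j w -> t k w.
    move=> w hw tjw; have wk : w != k by apply: contraTneq tjw => ->; rewrite t_asym.
    rewrite t_tour 1?eq_sym //; apply/negP => twk.
    have : (0 < cnt n (fun w => t j w && t w k))%N by apply/cnt_gt0P; exists w; rewrite ?tjw.
    lia.
  by have := cnt_sub_eq jk (score_mono kj hj) hj tkj; rewrite t_irr.
by have := cycle4 tki tij tjw twk; lia.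
Qed.

(* Two upsets [a -> b], [c -> d] cannot be exchanged for [a -> d], [c -> b]. *)
Lemma no_swap a b c d : up a b -> t b c -> up c d -> t d a -> False.
Proof.
by case/andP=> ab tab tbc /andP[cd tcd] tda; have := cycle4 tab tbc tcd tda; lia.
Qed.

Lemma outd_gt0 i j : up i j -> (0 < outd i)%N.
Proof. by move=> uij; have [_ hj _] := up_dom uij; apply/cnt_gt0P; exists j. Qed.

Lemma ind_gt0 i j : up i j -> (0 < ind j)%N.
Proof. by move=> uij; have [hi _ _] := up_dom uij; apply/cnt_gt0P; exists i. Qed.

Lemma outd_ind i : outd i = 0%N \/ ind i = 0%N.
Proof.
have [|/cnt_gt0P[j hj uij]] := posnP (outd i); first by left.
have [|/cnt_gt0P[k hk uki]] := posnP (ind i); first by right.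
by case: (no_up_path uki uij).
Qed.

Lemma up_excess i j : up i j -> 0 < D i /\ D j < 0.
Proof.
move=> uij; have := outd_gt0 uij; have := ind_gt0 uij.
have := outd_ind i; have := outd_ind j; rewrite /excess; lia.
Qed.

Lemma excess_gt0 i : 0 < D i -> outd i = D i :> int.
Proof. by have := outd_ind i; rewrite /excess; lia. Qed.

Lemma excess_lt0 i : D i < 0 -> ind i = - D i :> int.
Proof. by have := outd_ind i; rewrite /excess; lia. Qed.

Lemma source_target i : 0 < D i -> exists j, up i j.
Proof.
move=> Di; have e := excess_gt0 Di.
have /cnt_gt0P[j _ uij] : (0 < outd i)%N by lia.
by exists j.
Qed.

Lemma sink_origin j : D j < 0 -> exists i, up i j.
Proof.
move=> Dj; have e := excess_lt0 Dj.
have /cnt_gt0P[i _ uij] : (0 < ind j)%N by lia.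
by exists i.
Qed.

(** Vertex [i] beats [outd i] later vertices and all but [ind i] of the [i] earlier ones. *)
Lemma score_excess i : (i < n)%N -> (cnt n (t i))%:Z = D i + i%:Z.
Proof.
move=> hi; rewrite (cnt_split n (fun j => (i < j)%N)).
have := cnt_split n (t i) (fun j => (j < i)%N); rewrite cnt_ltn 1?ltnW // => iE.
have -> : cnt n (fun j => t i j && (i < j)%N) = outd i.
  by apply: eq_cnt => j _; rewrite andbC.
have e1 : cnt n (fun j => t i j && ~~ (i < j)%N) = cnt n (fun j => (j < i)%N && t i j).
  apply: eq_cnt => j _; have [->|ij] := eqVneq j i; first by rewrite t_irr ltnn.
  by rewrite andbC; congr andb; lia.
have e2 : cnt n (fun j => (j < i)%N && ~~ t i j) = ind i.
  by apply: eq_cnt => j hj; rewrite /up; case: ltnP => //= ji; rewrite (@t_tour j i) //; lia.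
by rewrite e1 /excess; lia.
Qed.

Lemma excess_drop i : (i.+1 < n)%N -> D i - 1 <= D i.+1.
Proof.
move=> hi; have := @score_mono i i.+1 (leqnSn _) hi.
by have := score_excess hi; have := score_excess (ltnW hi); lia.
Qed.

(** * Splitting off one block after a cut *)

Section Block.
Variable N : nat.
Hypothesis N_cut : forall i j, up i j -> (i < N)%N -> (j < N)%N.
Hypothesis D_N : 0 < D N.

Let N_lt : (N < n)%N.
Proof. by have [j /up_dom[]] := source_target D_N. Qed.

Let first_sink : exists y, [/\ (N < y < n)%N, D y < 0 & forall i, (N <= i < y)%N -> 0 <= D i].
Proof.
have [j uNj] := source_target D_N; have [_ hj Nj] := up_dom uNj.
have ex : exists i, (N <= i < n)%N && (D i < 0).
  by exists j; rewrite hj ltnW //=; case/up_excess: uNj.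
case: (ex_minnP ex) => y /andP[hy Dy] ymin.
have Ny : N != y by apply: contraTneq Dy => <-; lia.
exists y; split => // [|i hi]; first by lia.
rewrite leNgt; apply/negP => Di.
by have := ymin i; rewrite Di andbT; lia.
Qed.

(** Discrete continuity gives excess -1 to the first sink [y] and excess 1 to the last source [x]
    before it, so each lies on a single upset. The ban on exchanges then compares all sources and
    sinks of the block with the origin [a] of [y] and the target [g] of [x]; counting yields the
    shape, with [a = N] and [g] the last vertex. *)
Lemma block_step : exists k m,
  [/\ (0 < k)%N, (0 < m)%N, (N + (2 * k + m) <= n)%N,
     [/\ forall i, (i < k)%N -> D (N + i) = k%:Z - i%:Z,
        forall i, (i < m)%N -> D (N + k + i) = 0 &
        forall i, (i < k)%N -> D (N + k + m + i) = - (i.+1)%:Z] &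
     forall i j, up i j -> (i < N + (2 * k + m))%N -> (j < N + (2 * k + m))%N].
Proof.
have [y [/andP[Ny yn] Dy nneg]] := first_sink.
have uN i j : (N <= j)%N -> up i j -> (N <= i)%N.
  by move=> Nj uij; rewrite leqNgt; apply/negP => iN; have := N_cut uij iN; lia.
pose E i := (N <= i < y)%N && (0 < D i).
have E_lt i : E i -> (i < n)%N by rewrite /E; lia.
have target_ge e f : E e -> up e f -> (y <= f)%N.
  case/andP=> he De uef; have [_ Df] := up_excess uef; have [_ _ ef] := up_dom uef.
  by rewrite leqNgt; apply/negP => fy; have := nneg f; lia.
have origin_E e f : (N <= f)%N -> (e < y)%N -> up e f -> E e.
  by move=> Nf ey uef; rewrite /E (uN _ _ Nf uef) ey; case/up_excess: uef.
have EN : E N by rewrite /E leqnn Ny D_N.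
have [x [Ex xmax Dx]] : exists x, [/\ E x, forall e, E e -> (e <= x)%N & D x = 1].
  have bound e : E e -> (e <= y)%N by rewrite /E; lia.
  have ex : exists e, E e by exists N.
  case: (ex_maxnP ex bound) => x Ex xmax; exists x; split=> //.
  have /andP[xy Dx] := Ex.
  have drop : D x - 1 <= D x.+1 by apply: excess_drop; lia.
  suff : D x.+1 <= 0 by lia.
  have [->|xy'] := eqVneq x.+1 y; first lia.
  rewrite leNgt; apply/negP => Dx1; have := xmax x.+1; rewrite /E; lia.
have /andP[xy _] := Ex.
have Dy1 : D y = -1.
  have := nneg y.-1; have := @excess_drop y.-1.
  rewrite prednK; lia.
have [a uay] := sink_origin Dy.
have ay := let: And3 _ _ h := up_dom uay in h.
have Ea : E a by apply: origin_E uay; lia.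
have indy : ind y = 1%N by have := excess_lt0 Dy; lia.
have only_a e : up e y -> e = a.
  by move=> uey; have [he _ _] := up_dom uey; apply: (cnt1_inj indy _ _ uey uay) => //; exact: E_lt.
have [g uxg] : exists g, up x g by apply: source_target; lia.
have [xn gn xg] := up_dom uxg.
have Dg : D g < 0 by case/up_excess: uxg.
have yg : (y <= g)%N by apply: target_ge uxg.
have outx : outd x = 1%N by have := @excess_gt0 x; rewrite Dx; lia.
have only_g f : up x f -> f = g.
  by move=> uxf; have [_ hf _] := up_dom uxf; apply: (cnt1_inj outx _ _ uxf uxg).
(* [a] dominates every source before [y], since [y] has no other origin. *)
have P1 e f : E e -> up e f -> up a f.
  move=> Ee uef; have [ea|ea] := eqVneq e a; first by rewrite -ea.
  have [en fn ef] := up_dom uef; have yf := target_ge _ _ Ee uef.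
  have fa : f != a by lia.
  rewrite /up; have -> /= : (a < f)%N by lia.
  have an := E_lt _ Ea; rewrite t_tour //; last by rewrite eq_sym.
  apply/negP => tfa.
  have tye : t y e.
    by apply: t_back => //; [case/andP: Ee; lia|apply: contraNN ea => /only_a ->].
  exact: no_swap uay tye uef tfa.
(* Dually, every source before [y] hits the only target [g] of [x]. *)
have P2 e : E e -> up e g.
  move=> Ee; have [->//|nex] := eqVneq e x.
  have [f uef] : exists f, up e f by apply: source_target; case/andP: Ee.
  have [<-//|fg] := eqVneq f g.
  have [en fn ef] := up_dom uef; have yf := target_ge _ _ Ee uef.
  have eg : (e < g)%N by case/andP: Ee; lia.
  rewrite /up eg /= t_tour //; last lia.
  apply/negP => tge.
  have tfx : t f x by apply: t_back => //; [lia|apply: contraNN fg => /only_g ->].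
  exact: no_swap uxg tge uef tfx.
(* All sources up to [g] precede [y]: otherwise the last source [z] in [[y, g)] has excess 1 and,
   like [x], the only target [g]. *)
have P3 z : (N <= z <= g)%N -> 0 < D z -> E z.
  move=> hz Dz; have zg : z != g by apply: contraTneq Dz => ->; lia.
  rewrite /E Dz andbT ltnNge; case/andP: hz => -> zleg /=; apply/negP => yz.
  have {z Dz zg zleg yz} ex : exists z, (y <= z < g)%N && (0 < D z).
    by exists z; rewrite Dz; lia.
  have bound z : (y <= z < g)%N && (0 < D z) -> (z <= g)%N by lia.
  case: (ex_maxnP ex bound) => z /andP[/andP[yz zg] Dz] zmax.
  have zn : (z < n)%N by lia.
  have Dz1 : D z = 1.
    have drop : D z - 1 <= D z.+1 by apply: excess_drop; lia.
    suff : D z.+1 <= 0 by lia.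
    have [->|zg'] := eqVneq z.+1 g; first lia.
    by rewrite leNgt; apply/negP => Dz'; have := zmax z.+1; lia.
  have outz : outd z = 1%N by have := excess_gt0 Dz; lia.
  have zx : (x < z)%N by lia.
  have [b uzb] := source_target Dz; have [_ bn zb] := up_dom uzb.
  have uzg : up z g.
    have [<-//|bg] := eqVneq b g.
    have tbx : t b x by apply: t_back => //; [lia|apply: contraNN bg => /only_g ->].
    have tgz : t g z.
      apply: t_back => //; apply: contraNN bg => uzg.
      by apply/eqP; apply: (cnt1_inj outz _ _ uzb uzg).
    by case: (no_swap uxg tgz uzb tbx).
  have only_z f : up z f -> f = g.
    by move=> uzf; have [_ hf _] := up_dom uzf; apply: (cnt1_inj outz _ _ uzf uzg).
  have indg := @cntD1 n (up^~ g) x xn uxg.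
  have indg' : (0 < cnt n (fun i => (i != x) && up i g))%N.
    by apply/cnt_gt0P; exists z => //; rewrite uzg andbT; lia.
  have indgE := excess_lt0 Dg; rewrite /ind in indgE.
  (* [x] and [z] both have [g] as only target, so a sink of indegree one less than [g],
     whose origins all hit [g], cannot exist. *)
  have [b' hb' Db'] : exists2 b', (z <= b' <= g)%N & D b' = D g + 1.
    apply: descent_ivt; [lia| |lia].
    by move=> i hi; apply: excess_drop; lia.
  have b'z : b' != z by apply/eqP => bE; rewrite bE in Db'; lia.
  have b'g : b' != g by apply/eqP => bE; rewrite bE in Db'; lia.
  have Db'0 : D b' < 0 by lia.
  have b'n : (b' < n)%N by lia.
  have := excess_lt0 Db'0; rewrite /ind.
  suff : (cnt n (up^~ b') <= cnt n (fun i => (i != z) && ((i != x) && up i g)))%N.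
    have := @cntD1 n (fun i => (i != x) && up i g) z zn.
    by rewrite uzg andbT => /(_ ltac:(lia)); lia.
  apply: cnt_le => e en ueb; have [_ _ eb] := up_dom ueb.
  have ez : e != z by apply: contraNneq b'g => ez; rewrite (only_z b') -?ez.
  have ex' : e != x by apply: contraNneq b'g => ex'; rewrite (only_g b') -?ex'.
  rewrite ez ex' /= /up; have eg : (e < g)%N by lia.
  rewrite eg /= t_tour //; last by lia.
  apply/negP => tge.
  have tbx : t b' x by apply: t_back => //; [lia|apply: contraNN b'g => /only_g ->].
  exact: no_swap ueb tbx uxg tge.
have Wg : ind g = cnt n E.
  apply: eq_cnt => e en; apply/idP/idP; last exact: P2.
  move=> ueg; have [_ _ eg] := up_dom ueg; have [De _] := up_excess ueg.
  have Ne : (N <= e)%N by apply: uN ueg; lia.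
  by apply: P3 => //; lia.
have Dgk : D g = - (cnt n E)%:Z by have := excess_lt0 Dg; lia.
pose T i := (y <= i <= g)%N && (D i < 0).
(* |E| = indegree of [g] <= |T| <= outdegree of [a] <= |E|, so equality holds throughout. *)
have T_surj v : (0 < v <= cnt n E)%N -> exists i, [/\ (i < n)%N, T i & `|D i|%N = v].
  move=> hv; have [i hi Di] : exists2 i, (N <= i <= g)%N & D i = - v%:Z.
    apply: descent_ivt; [lia| |lia].
    by move=> i hi; apply: excess_drop; lia.
  exists i; split; [lia| |by rewrite Di; lia].
  rewrite /T; suff : ~~ (i < y)%N by lia.
  by apply/negP => iy; have := nneg i; lia.
have EleT : (cnt n E <= cnt n T)%N by exact: cnt_surj T_surj.
have T_U f : (f < n)%N -> T f -> up a f.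
  move=> fn /andP[hf Df]; have [e uef] := sink_origin Df; have [_ _ ef] := up_dom uef.
  apply: (P1 e) => //; apply: P3; last by case/up_excess: uef.
  by have := uN _ _ _ uef; lia.
have Da : D a = (outd a)%:Z by have /andP[_ Da] := Ea; have := excess_gt0 Da.
have TleU : (cnt n T <= outd a)%N by exact: cnt_le.
have E_surj v : (0 < v <= outd a)%N ->
    exists i, [/\ (i < n)%N, (a <= i)%N && E i & `|D i|%N = v].
  move=> hv; have [i hi Di] : exists2 i, (a <= i <= x)%N & D i = v%:Z.
    apply: descent_ivt; [exact: xmax| |lia].
    by move=> i hi; apply: excess_drop; lia.
  exists i; split; [lia| |by rewrite Di; lia].
  by rewrite /E; case/andP: Ea; lia.
have UleE : (outd a <= cnt n (fun i => (a <= i)%N && E i))%N by exact: cnt_surj E_surj.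
have E'leE : (cnt n (fun i => (a <= i)%N && E i) <= cnt n E)%N.
  by apply: cnt_le => i _ /andP[].
(* Equality in the chain puts all of [E], in particular [N], at or after [a]. *)
have aN : a = N.
  have Eall : forall i, (i < n)%N -> E i -> (a <= i)%N && E i.
    by apply: cnt_sub_eq; [move=> i _ /andP[]|lia].
  have /andP[aN _] := Eall N N_lt EN.
  by case/andP: Ea; lia.
pose k := cnt n E.
have DNk : D N = k%:Z by rewrite -aN /k; lia.
(* All values 1, ..., [k] occur among only [k] sources, so each occurs once; likewise for the sinks
   in [T]. *)
have E_inj : forall i j, (i < n)%N -> (j < n)%N -> E i -> E j -> D i = D j -> i = j.
  move=> i j hi hj Ei Ej Dij.
  apply: (@cnt_surj_inj n E (fun i => `|D i|%N) k) => //; last by rewrite Dij.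
  move=> v hv; have [|h [hn /andP[_ Eh] fh]] := E_surj v; first by rewrite -/k in E'leE *; lia.
  by exists h.
have T_inj : forall i j, (i < n)%N -> (j < n)%N -> T i -> T j -> D i = D j -> i = j.
  move=> i j hi hj Ti Tj Dij.
  by apply: (@cnt_surj_inj n T (fun i => `|D i|%N) k) => //; [lia|rewrite Dij].
have k_gt0 : (0 < k)%N by lia.
have E_le e : E e -> 0 < D e <= k%:Z.
  move=> Ee; have De : 0 < D e by case/andP: Ee.
  have : (outd e <= outd a)%N by apply: cnt_le => f _; apply: P1.
  by have := excess_gt0 De; lia.
(* The excess following [k - i] lies between [k - i - 1] and [k]; all these values except
   [k - i - 1] are already taken. *)
have D_src i : (i < k)%N -> E (N + i)%N /\ D (N + i) = k%:Z - i%:Z.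
  elim/ltn_ind: i => -[|i] IH ik; first by rewrite addn0 DNk; split; [exact: EN|lia].
  have [Ei Di] := IH i (ltnSn i) (ltnW ik).
  have iy : (N + i < y)%N by case/andP: Ei; lia.
  have drop : D (N + i) - 1 <= D (N + i).+1 by apply: excess_drop; lia.
  rewrite addnS.
  have iy' : (N + i).+1 != y by apply: contraTneq Dy => <-; lia.
  have Ei' : E (N + i).+1 by rewrite /E; lia.
  split=> //; have leDk := E_le _ Ei'.
  have [|neq] := eqVneq (D (N + i).+1) (k%:Z - i.+1%:Z); first by [].
  pose h := `|k%:Z - D (N + i).+1|%N.
  have hi : (h < i.+1)%N by lia.
  have [Eh Dh] := IH h hi ltac:(lia).
  have : (N + h)%N = (N + i).+1.
    by apply: E_inj => //; [exact: E_lt|exact: E_lt|rewrite Dh /h; lia].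
  by lia.
have E_lt_k e : E e -> (e < N + k)%N.
  move=> Ee; have De := E_le _ Ee.
  pose h := `|k%:Z - D e|%N.
  have [Eh Dh] := D_src h ltac:(lia).
  have <- : (N + h)%N = e.
    by apply: E_inj => //; [exact: E_lt|exact: E_lt|rewrite Dh /h; lia].
  by lia.
have D_zero i : (N + k <= i < y)%N -> D i = 0.
  move=> hi; have := nneg i ltac:(lia); rewrite le_eqVlt => /orP[/eqP //|Di].
  by have := E_lt_k i; rewrite /E Di; lia.
(* There is at least one zero, since a drop of one cannot lead from 1 to -1. *)
have Nky : (N + k < y)%N.
  have [El Dl] := D_src k.-1 ltac:(lia).
  have ly : (N + k.-1 < y)%N by case/andP: El; lia.
  have drop : D (N + k.-1) - 1 <= D (N + k.-1).+1 by apply: excess_drop; lia.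
  have : (N + k.-1).+1 != y by apply: contraTneq Dy => <-; lia.
  by lia.
have T_le i : T i -> - k%:Z <= D i < 0.
  case/andP => hi Di; rewrite Di andbT.
  have : (ind i <= cnt n E)%N.
    apply: cnt_le => e en uei; have [_ _ ei] := up_dom uei; apply: P3; last by case/up_excess: uei.
    by have := uN _ _ _ uei; lia.
  by have := excess_lt0 Di; lia.
have D_snk i : (i < k)%N -> T (y + i)%N /\ D (y + i) = - i.+1%:Z.
  elim/ltn_ind: i => -[|i] IH ik.
    by rewrite addn0 Dy1 /T Dy leqnn yg.
  have [Ti Di] := IH i (ltnSn i) (ltnW ik).
  have ig : (y + i <= g)%N by case/andP: Ti; lia.
  have ig' : (y + i)%N != g by apply: contraTneq ik => ig'; move: Dgk; rewrite -ig' Di; lia.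
  have drop : D (y + i) - 1 <= D (y + i).+1 by apply: excess_drop; lia.
  rewrite addnS.
  have Dle0 : D (y + i).+1 <= 0.
    by rewrite leNgt; apply/negP => Dpos; have := P3 (y + i).+1 ltac:(lia) Dpos; rewrite /E; lia.
  (* If the excess returned to 0 before [g], its descent to [D g] would meet -1 a second time,
     against [T_inj]. *)
  have Dlt0 : D (y + i).+1 < 0.
    rewrite lt_neqAle Dle0 andbT; apply/eqP => D0.
    have [j hj Dj] : exists2 j, ((y + i).+1 <= j <= g)%N & D j = -1.
      apply: descent_ivt; [lia| |lia].
      by move=> j hj; apply: excess_drop; lia.
    suff : y = j by lia.
    apply: T_inj => //; [lia|by rewrite /T leqnn yg|by rewrite /T Dj; lia|lia].
  have Ti' : T (y + i).+1 by rewrite /T Dlt0; lia.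
  split=> //; have leDk := T_le _ Ti'.
  have [|neq] := eqVneq (D (y + i).+1) (- i.+2%:Z); first by [].
  pose h := `|D (y + i).+1|.-1%N.
  have hi : (h < i.+1)%N by lia.
  have [Th Dh] := IH h hi ltac:(lia).
  have : (y + h)%N = (y + i).+1.
    by apply: T_inj => //; [lia|lia|rewrite Dh /h; lia].
  by lia.
have gE : g = (y + k.-1)%N.
  have [Tl Dl] := D_snk k.-1 ltac:(lia).
  have Tg : T g by rewrite /T Dg leqnn yg.
  by apply: T_inj => //; [case/andP: Tl; lia|lia].
exists k, (y - (N + k))%N; split; [lia|lia|lia| |].
  split=> i hi; first by case: (D_src i hi).
    by apply: D_zero; lia.
  rewrite (_ : (N + k + (y - (N + k)) + i)%N = (y + i)%N); last lia.
  by case: (D_snk i hi).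
(* An upset starting in the block has its origin in [E], so [a] hits its target too; by equality of
   the counts this target lies in [T], hence not beyond [g]. *)
move=> i j uij hi; have iN : (N <= i)%N \/ (i < N)%N by lia.
case: iN => [Ni|iN]; last by have := N_cut uij iN; lia.
have Ei : E i by apply: P3; [lia|case/up_excess: uij].
have uaj := P1 _ _ Ei uij.
have [_ jn _] := up_dom uaj.
have Tj : T j.
  by apply: (cnt_sub_eq T_U _ jn uaj); apply: leq_trans UleE (leq_trans E'leE EleT).
by case/andP: Tj; lia.
Qed.
End Block.

(** Blocks are split off from the left, by induction on the number of vertices after the cut [N]. A
    vertex of excess 0 lies on no upset and forms the block [(0, 1)]. *)
Lemma block_decomposition : exists bs,
  [/\ all valid bs, btotal bs = n & forall i, (i < n)%N -> D i = bexcess bs i].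
Proof.
suff H N : (N <= n)%N -> (forall i j, up i j -> (i < N)%N -> (j < N)%N) -> exists bs,
    [/\ all valid bs, btotal bs = (n - N)%N &
       forall i, (N + i < n)%N -> D (N + i) = bexcess bs i].
  by have [|bs] := H 0%N isT _; [|rewrite subn0; exists bs].
have [r] := ubnP (n - N); elim: r N => // r IH N nN Nn cutN.
have [->|neq] := eqVneq N n.
  by exists [::]; split=> // [|i]; rewrite ?subnn // ltnNge leq_addr.
have ltNn : (N < n)%N by rewrite ltn_neqAle neq.
have [DN|DN|DN] := ltrgt0P (D N).
- have [k [m [k0 m0 kmn [Dsrc Dzero Dsnk] cut]]] := block_step cutN DN.
  have [| |bs [vbs tbs Dbs]] := IH (N + (2 * k + m))%N _ _ cut; [lia..|].
  exists ((k, m) :: bs); split.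
  + by rewrite /= vbs /valid /= m0 andbT; apply/implyP; lia.
  + by move: tbs; rewrite /btotal /= /bsize /=; lia.
  move=> i hi /=.
  case: ltnP => ik; first exact: Dsrc.
  case: ltnP => ikm; first by have := Dzero (i - k)%N ltac:(lia); rewrite -addnA subnKC.
  case: ltnP => iL.
    have := Dsnk (i - (k + m))%N ltac:(lia).
    by rewrite -!addnA [(k + (m + _))%N]addnA subnKC.
  by have := Dbs (i - (2 * k + m))%N ltac:(lia); rewrite -addnA subnKC.
(* A sink at [N] would have an origin below [N], an upset across the cut. *)
- have [i uiN] := sink_origin DN; have [_ _ iN] := up_dom uiN.
  by have := cutN _ _ uiN iN; rewrite ltnn.
have cut i j : up i j -> (i < N.+1)%N -> (j < N.+1)%N.
  move=> uij; rewrite ltnS leq_eqVlt => /orP[/eqP iN|/(cutN _ _ uij)/leqW //].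
  by have [] := up_excess uij; rewrite iN DN ltxx.
have [|bs [vbs tbs Dbs]] := IH N.+1 _ ltNn cut; first lia.
exists ((0%N, 1%N) :: bs); split; [by rewrite /= vbs| |].
  by move: tbs; rewrite /btotal /= /bsize /=; lia.
move=> [|i] hi /=; first by rewrite addn0.
by rewrite -addSnnS subSS subn0; apply: Dbs; lia.
Qed.

End Structure.

(** * Uniqueness of the minimiser *)

Lemma int_mxE n (A : 'M[bool]_n) i j : int_mx A i j = (A i j : nat)%:Z.
Proof. by rewrite mxE. Qed.

Lemma tournamentP n (A : 'M[bool]_n) :
  reflect ((forall i, A i i = false) /\ (forall i j, i != j -> A i j = ~~ A j i))
    (tournament_mx A).
Proof.
have E i j : ((int_mx A + (int_mx A)^T) i j == (const_mx 1 - 1%:M : 'M[int]_n) i j) =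
    (A i j + A j i == (i != j))%N.
  by rewrite !mxE; case: (i == j); case: (A i j); case: (A j i).
apply: (iffP eqP) => [AE|[Aii Aij]].
  split=> [i|i j ij].
    by have := E i i; rewrite AE !eqxx; case: (A i i).
  by have := E i j; rewrite AE eqxx ij; case: (A i j); case: (A j i).
apply/matrixP => i j; apply/eqP; rewrite E.
by have [->|ij] := eqVneq i j; [rewrite Aii|rewrite Aij //; case: (A j i)].
Qed.

Lemma row_sumsE n (A : 'M[bool]_n) i : row_sums A 0 i = #|[set j | A i j]|%:Z.
Proof.
rewrite mxE -sum1dep_card -natz natr_sum [RHS]big_mkcond /=.
by apply: eq_bigr => j _; rewrite int_mxE; case: (A i j).
Qed.

(** This form is linear in the entries, so differences and arc reversals can be computed
    entrywise. *)
Lemma upsetsE n (A : 'M[bool]_n) :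
  (upsets A)%:Z = \sum_(i < n) \sum_(j < n) (i < j)%N%:Z * int_mx A i j.
Proof.
rewrite pair_bigA /= /upsets -sum1dep_card -natz natr_sum big_mkcond /=.
by apply: eq_bigr => p _; rewrite int_mxE; case: (A _ _); case: ltnP.
Qed.

(* The scores fix [\sum_i phi i * (row sum i)], so twice the difference of the upset numbers is
   [\sum_(i, j) ([i < j] - [j < i] - (phi i - phi j)) (B i j - A i j)], whose terms are >= 0. *)
Lemma gap_minimal n (A B : 'M[bool]_n) (phi : 'I_n -> rat) :
  tournament_mx A -> tournament_mx B -> row_sums A = row_sums B ->
  (forall i j : 'I_n, (i < j)%N -> if A i j then 1 < phi i - phi j else phi i - phi j < 1) ->
  A != B -> (upsets A < upsets B)%N.
Proof.
move=> /tournamentP[Aii Aij] /tournamentP[Bii Bij] RAB gap AB.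
pose z i j : rat := (int_mx B i j - int_mx A i j)%:~R.
have zN i j : z j i = - z i j.
  rewrite /z !mxE; have [->|ij] := eqVneq i j; first by rewrite Aii Bii subrr oppr0.
  by rewrite (Aij i j) // (Bij i j) //; case: (A j i); case: (B j i).
have row0 i : \sum_j z i j = 0.
  rewrite -rmorph_sum /= sumrB.
  by have := congr1 (fun R : 'rV_n => R 0 i) RAB; rewrite !mxE => ->; rewrite subrr.
have phi0 : \sum_i \sum_j phi i * z i j = 0.
  by apply: big1 => i _; rewrite -mulr_sumr row0 mulr0.
pose d : rat := \sum_(i < n) \sum_(j < n) (i < j)%N%:R * z i j.
have dE : d = (upsets B)%:R - (upsets A)%:R.
  rewrite -[(upsets B)%:R]/((upsets B)%:Z%:~R) -[(upsets A)%:R]/((upsets A)%:Z%:~R).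
  rewrite !upsetsE -rmorphB -sumrB rmorph_sum /=; apply: eq_bigr => i _.
  rewrite -sumrB rmorph_sum /=; apply: eq_bigr => j _.
  by rewrite -mulrBr rmorphM.
pose w (i j : 'I_n) : rat := ((i < j)%N%:R - (j < i)%N%:R - (phi i - phi j)) * z i j.
have wE : \sum_i \sum_j w i j = 2 * d.
  have d' : \sum_(i < n) \sum_(j < n) (j < i)%N%:R * z i j = - d.
    rewrite exchange_big /= -sumrN; apply: eq_bigr => i _; rewrite -sumrN.
    by apply: eq_bigr => j _; rewrite zN mulrN.
  have phi0' : \sum_i \sum_j phi j * z i j = 0.
    rewrite exchange_big /=; apply: big1 => i _.
    by under eq_bigr do rewrite zN mulrN; rewrite sumrN -mulr_sumr row0 mulr0 oppr0.
  transitivity (d - - d - (0 - 0)); last by ring.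
  rewrite -[in RHS]d' -[X in _ - (X - _)]phi0 -[X in _ - (_ - X)]phi0' /d -!sumrB.
  apply: eq_bigr => i _; rewrite -!sumrB; apply: eq_bigr => j _.
  by rewrite /w; ring.
(* For [i < j] the factor [1 - (phi i - phi j)] is nonzero and never opposite in sign to
   [B i j - A i j]. *)
have wlt (i j : 'I_n) : (i < j)%N -> (0 <= w i j) && ((z i j != 0) ==> (0 < w i j)).
  move=> ij; have := gap i j ij; rewrite /w /z !int_mxE ij ltnNge ltnW //=.
  case: (A i j); case: (B i j) => /=; rewrite ?subrr ?mulr0 ?eqxx //= => g; nra.
have wC i j : w i j = w j i by rewrite /w zN; ring.
have wge0 i j : 0 <= w i j.
  have [ij|ij|/val_inj ->] := ltngtP i j; last by rewrite /w /z !int_mxE Aii Bii subrr mulr0.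
    by case/andP: (wlt _ _ ij).
  by rewrite wC; case/andP: (wlt _ _ ij).
suff d0 : 0 < d by move: d0; rewrite dE subr_gt0 ltr_nat.
have : 0 < 2 * d; last by rewrite pmulr_rgt0.
rewrite -wE lt_neqAle eq_sym; apply/andP; split; last first.
  by apply: sumr_ge0 => i _; apply: sumr_ge0 => j _.
(* A zero total makes every nonnegative term vanish, so [z] is zero and [A = B]. *)
apply: contra AB => /eqP W0; apply/eqP/matrixP => i j.
have Wi0 : \sum_j w i j = 0.
  by apply: (psumr_eq0P _ W0) => // h _; apply: sumr_ge0.
have wij0 : w i j = 0 by apply: (psumr_eq0P _ Wi0).
have zij0 : z i j = 0.
  have zij (k l : 'I_n) : (k < l)%N -> w k l = 0 -> z k l = 0.
    move=> /wlt/andP[_ /implyP H] wkl; apply/eqP/negPn/negP => /H; by rewrite wkl ltxx.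
  have [ij|ij|/val_inj ->] := ltngtP i j; first exact: zij.
    by rewrite zN (zij j i) ?oppr0 // wC.
  by rewrite /z !int_mxE Aii Bii.
by move/eqP: zij0; rewrite /z !int_mxE; case: (A i j); case: (B i j).
Qed.

(** * Arc reversals *)

Definition rev_arc n (A : 'M[bool]_n) (x y : 'I_n) : 'M[bool]_n :=
  \matrix_(i, j) if (i == x) && (j == y) then false
                 else if (i == y) && (j == x) then true else A i j.

Section ArcReversal.
Variables (n : nat) (A : 'M[bool]_n) (x y : 'I_n).
Hypotheses (tA : tournament_mx A) (Axy : A x y).

Lemma rev_arc_int : int_mx (rev_arc A x y) = int_mx A - delta_mx x y + delta_mx y x.
Proof.
have /tournamentP[Aii Aij] := tA.
have xy : x != y by apply: contraTneq Axy => ->; rewrite Aii.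
have Ayx : A y x = false by rewrite Aij 1?eq_sym // Axy.
apply/matrixP => i j; rewrite !mxE.
have [->|ix] := eqVneq i x; have [->|jy] := eqVneq j y => /=; rewrite ?(negbTE xy) ?Axy //=.
- by rewrite addr0 subr0.
- by rewrite [y == x]eq_sym (negbTE xy) andbF subr0 addr0.
- have [->|iy] := eqVneq i y; have [->|jx] := eqVneq j x => /=; rewrite ?Ayx ?subr0 ?addr0 //.
Qed.

Lemma rev_arc_tournament : tournament_mx (rev_arc A x y).
Proof.
rewrite /tournament_mx rev_arc_int -(eqP tA); apply/eqP/matrixP => i j.
by rewrite !mxE ![(j == _) && _]andbC; ring.
Qed.

(** One unit of score moves from [x] to [y], so reversing all arcs of a directed cycle keeps every
    score. *)
Lemma rev_arc_row_sums :
  row_sums (rev_arc A x y) = row_sums A - delta_mx 0 x + delta_mx 0 y.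
Proof.
have delta_sum (u v i : 'I_n) : \sum_j (delta_mx u v : 'M[int]_n) i j = (i == u)%:R.
  rewrite (bigD1 v) //= big1 ?addr0 => [|j jv]; rewrite !mxE ?eqxx ?andbT //.
  by rewrite (negbTE jv) andbF.
apply/rowP => i; rewrite !mxE.
transitivity (\sum_j (int_mx A i j - (delta_mx x y : 'M[int]_n) i j
                                   + (delta_mx y x : 'M[int]_n) i j)).
  by apply: eq_bigr => j _; rewrite rev_arc_int !mxE.
by rewrite big_split sumrB /= !delta_sum.
Qed.

Lemma rev_arc_upsets :
  (upsets (rev_arc A x y))%:Z = (upsets A)%:Z - (x < y)%N%:Z + (y < x)%N%:Z.
Proof.
have delta_sum (u v : 'I_n) :
    \sum_(i < n) \sum_(j < n) (i < j)%N%:Z * (delta_mx u v : 'M[int]_n) i j = (u < v)%N%:Z.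
  rewrite (bigD1 u) //= [X in _ + X]big1 ?addr0 => [|i iu]; last first.
    by apply: big1 => j _; rewrite mxE (negbTE iu) mulr0.
  rewrite (bigD1 v) //= big1 ?addr0 => [|j jv]; rewrite !mxE ?eqxx ?mulr1 //.
  by rewrite (negbTE jv) andbF mulr0.
rewrite !upsetsE rev_arc_int -(delta_sum x y) -(delta_sum y x) -sumrB -big_split /=.
apply: eq_bigr => i _; rewrite -sumrB -big_split /=; apply: eq_bigr => j _.
by rewrite !mxE; ring.
Qed.

Lemma rev_arcE i j : ((i == x) && (j == y)) || ((i == y) && (j == x)) = false ->
  rev_arc A x y i j = A i j.
Proof. by rewrite mxE; case: ifP => //= _ ->. Qed.

End ArcReversal.

(** Vertices become natural numbers, with no arcs out of range, so that index arithmetic such as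
    [N + i] needs no bound proofs. *)
Definition nat_rel n (A : 'M[bool]_n) (i j : nat) : bool :=
  if (insub i, insub j) is (Some i', Some j') then A i' j' else false.

Lemma nat_relE n (A : 'M[bool]_n) (i j : 'I_n) : nat_rel A i j = A i j.
Proof. by rewrite /nat_rel !valK. Qed.

Lemma nat_rel_dom n (A : 'M[bool]_n) i j : nat_rel A i j -> (i < n)%N && (j < n)%N.
Proof. by rewrite /nat_rel; case: insubP => // i' -> _; case: insubP => // j' ->. Qed.

Lemma row_sums_nat n (A : 'M[bool]_n) (i : 'I_n) : row_sums A 0 i = (cnt n (nat_rel A i))%:Z.
Proof. by rewrite row_sumsE /cnt; congr Posz; apply: eq_card => j; rewrite !inE nat_relE. Qed.

Section NatRel.
Variables (n : nat) (A : 'M[bool]_n).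
Hypothesis tA : tournament_mx A.

Lemma nat_rel_irr i : nat_rel A i i = false.
Proof.
apply/negP => tii; have /andP[hi _] := nat_rel_dom tii.
have /tournamentP[Aii _] := tA.
by move: tii; rewrite (nat_relE A (Ordinal hi) (Ordinal hi)) Aii.
Qed.

Lemma nat_rel_tournament i j : (i < n)%N -> (j < n)%N -> i != j ->
  nat_rel A i j = ~~ nat_rel A j i.
Proof.
move=> hi hj ij; have /tournamentP[_ Aij] := tA.
by rewrite (nat_relE A (Ordinal hi) (Ordinal hj)) (nat_relE A (Ordinal hj) (Ordinal hi)) Aij.
Qed.

End NatRel.

(** * Short cycles in a unique minimiser *)

Section UniqueMinimum.
Variables (n : nat) (A : 'M[bool]_n).
Hypothesis tA : tournament_mx A.
Hypothesis minA : forall B, tournament_mx B -> row_sums B = row_sums A -> B != A ->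
  (upsets A < upsets B)%N.

Lemma arc_neq x y : A x y -> x != y.
Proof.
by have /tournamentP[Aii _] := tA; apply: contraTneq => ->; rewrite Aii.
Qed.

Lemma arc_asym x y : A x y -> A y x = false.
Proof.
move=> Axy; have /tournamentP[_ Aij] := tA.
by rewrite Aij ?Axy // eq_sym arc_neq.
Qed.

Let lt_or_gt (x y : 'I_n) : x != y -> ((x < y)%N + (y < x)%N = 1)%N.
Proof. by rewrite -(inj_eq val_inj) /=; case: ltngtP. Qed.

(** Reversing the cycle keeps the scores and turns [u] upsets into [3 - u]; strict minimality gives
    [u < 3 - u]. *)
Lemma short_cycle3 a b c : A a b -> A b c -> A c a ->
  ((a < b)%N + (b < c)%N + (c < a)%N <= 1)%N.
Proof.
move=> ab bc ca.
have [nab nbc nca] := And3 (arc_neq ab) (arc_neq bc) (arc_neq ca).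
pose A1 := rev_arc A a b; pose A2 := rev_arc A1 b c; pose A3 := rev_arc A2 c a.
have E := (negbTE nab, negbTE nbc, negbTE nca, eq_sym b a, eq_sym c b, eq_sym a c, andbF).
have t1 : tournament_mx A1 by exact: rev_arc_tournament.
have bc1 : A1 b c by rewrite rev_arcE // !E.
have t2 : tournament_mx A2 by exact: rev_arc_tournament.
have ca2 : A2 c a by rewrite !rev_arcE // !E.
have t3 : tournament_mx A3 by exact: rev_arc_tournament.
have r3 : row_sums A3 = row_sums A.
  by rewrite /A3 /A2 /A1 !rev_arc_row_sums //; apply/rowP => i; rewrite !mxE; ring.
have := minA t3 r3.
(* The reversed matrix has the arc from [a] to [c], which [A] lacks. *)
have n3 : A3 != A.
  apply/eqP => A3A; have := arc_asym ca; rewrite -A3A /A3 mxE.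
  by rewrite !E !eqxx.
have := rev_arc_upsets t2 ca2; have := rev_arc_upsets t1 bc1; have := rev_arc_upsets tA ab.
rewrite -/A1 -/A2 -/A3 => e1 e2 e3 /(_ n3).
move: e1 e2 e3 (lt_or_gt nab) (lt_or_gt nbc) (lt_or_gt nca).
move: (nat_of_bool (a < b)%N) (nat_of_bool (b < a)%N) (nat_of_bool (b < c)%N) (nat_of_bool (c < b)%N).
move: (nat_of_bool (a < c)%N) (nat_of_bool (c < a)%N).
by move: (upsets A) (upsets A1) (upsets A2) (upsets A3); clear; lia.
Qed.

(** As for triangles, now with [u < 4 - u], so again [u <= 1]. *)
Lemma short_cycle4 a b c d : A a b -> A b c -> A c d -> A d a ->
  ((a < b)%N + (b < c)%N + (c < d)%N + (d < a)%N <= 1)%N.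
Proof.
move=> ab bc cd da.
have [nab nbc ncd nda] := And4 (arc_neq ab) (arc_neq bc) (arc_neq cd) (arc_neq da).
(* Opposite vertices differ as well, so no reversal disturbs an arc still to be reversed. *)
have nac : a != c by apply: contraTneq ab => ->; rewrite (arc_asym bc).
have nbd : b != d by apply: contraTneq bc => ->; rewrite (arc_asym cd).
pose A1 := rev_arc A a b; pose A2 := rev_arc A1 b c.
pose A3 := rev_arc A2 c d; pose A4 := rev_arc A3 d a.
have E := (negbTE nab, negbTE nbc, negbTE ncd, negbTE nda, negbTE nac, negbTE nbd,
  eq_sym b a, eq_sym c b, eq_sym d c, eq_sym a d, eq_sym c a, eq_sym d b, andbF).
have t1 : tournament_mx A1 by exact: rev_arc_tournament.
have bc1 : A1 b c by rewrite rev_arcE // !E.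
have t2 : tournament_mx A2 by exact: rev_arc_tournament.
have cd2 : A2 c d by rewrite !rev_arcE // !E.
have t3 : tournament_mx A3 by exact: rev_arc_tournament.
have da3 : A3 d a by rewrite !rev_arcE // !E.
have t4 : tournament_mx A4 by exact: rev_arc_tournament.
have r4 : row_sums A4 = row_sums A.
  by rewrite /A4 /A3 /A2 /A1 !rev_arc_row_sums //; apply/rowP => i; rewrite !mxE; ring.
have n4 : A4 != A.
  apply/eqP => A4A; have := arc_asym da; rewrite -A4A /A4 mxE.
  by rewrite !E !eqxx.
have := minA t4 r4 n4.
have := rev_arc_upsets t3 da3; have := rev_arc_upsets t2 cd2.
have := rev_arc_upsets t1 bc1; have := rev_arc_upsets tA ab.
rewrite -/A1 -/A2 -/A3 -/A4.
move: (lt_or_gt nab) (lt_or_gt nbc) (lt_or_gt ncd) (lt_or_gt nda).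
move: (nat_of_bool (a < b)%N) (nat_of_bool (b < a)%N) (nat_of_bool (b < c)%N) (nat_of_bool (c < b)%N).
move: (nat_of_bool (c < d)%N) (nat_of_bool (d < c)%N) (nat_of_bool (d < a)%N) (nat_of_bool (a < d)%N).
by move: (upsets A) (upsets A1) (upsets A2) (upsets A3) (upsets A4); clear; lia.
Qed.

Lemma unique_min_blocks :
    (forall i j : 'I_n, (i <= j)%N -> row_sums A 0 i <= row_sums A 0 j) ->
  exists bs, [/\ all valid bs, btotal bs = n &
    forall i : 'I_n, row_sums A 0 i = bexcess bs i + (i : nat)%:Z].
Proof.
move=> mono.
have c3 a b c : nat_rel A a b -> nat_rel A b c -> nat_rel A c a ->
    ((a < b) + (b < c) + (c < a) <= 1)%N.
  move=> ab bc ca; have /andP[ha hb] := nat_rel_dom ab; have /andP[hc _] := nat_rel_dom ca.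
  have := @short_cycle3 (Ordinal ha) (Ordinal hb) (Ordinal hc).
  by rewrite -!nat_relE /=; apply.
have c4 a b c d : nat_rel A a b -> nat_rel A b c -> nat_rel A c d -> nat_rel A d a ->
    ((a < b) + (b < c) + (c < d) + (d < a) <= 1)%N.
  move=> ab bc cd da; have /andP[ha hb] := nat_rel_dom ab; have /andP[hc hd] := nat_rel_dom cd.
  have := @short_cycle4 (Ordinal ha) (Ordinal hb) (Ordinal hc) (Ordinal hd).
  by rewrite -!nat_relE /=; apply.
have smono i j : (i <= j)%N -> (j < n)%N -> (cnt n (nat_rel A i) <= cnt n (nat_rel A j))%N.
  move=> ij hj; have := mono (Ordinal (leq_ltn_trans ij hj)) (Ordinal hj) ij.
  by rewrite !row_sums_nat.
have [bs [vbs tbs Dbs]] := block_decomposition (@nat_rel_dom _ A) (nat_rel_tournament tA)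
  (nat_rel_irr tA) c3 c4 smono.
exists bs; split=> // i; rewrite row_sums_nat -Dbs; last exact: ltn_ord.
by rewrite (score_excess (nat_rel_tournament tA) (nat_rel_irr tA)).
Qed.

End UniqueMinimum.

Definition bscores n (bs : seq (nat * nat)) : 'rV[int]_n :=
  \row_(i < n) (bexcess bs i + (i : nat)%:Z).

Lemma unique_Umin_blocks n (R : 'rV[int]_n) : feasible R -> #|Umin R| = 1%N ->
  exists bs, [/\ all valid bs, btotal bs = n & R = bscores n bs].
Proof.
case=> mono _ _ /eqP/cards1P[A UA].
have : A \in Umin R by rewrite UA set11.
rewrite !inE => /andP[/andP[tA /eqP rA] /forall_inP minA].
subst R.
have [|bs [vbs tbs Dbs]] := unique_min_blocks tA _ mono; last first.
  by exists bs; split=> //; apply/rowP => i; rewrite Dbs mxE.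
(* A matrix [B] with the same scores and no more upsets than [A] is again a minimiser, hence equal
   to [A]. *)
move=> B tB rB BA; rewrite ltnNge; apply: contra BA => BleA.
rewrite -in_set1 -UA !inE tB rB eqxx /=.
apply/forall_inP => D; rewrite inE => tD.
by apply: leq_trans BleA (minA _ _); rewrite inE.
Qed.

(** * The tournament of a block sequence *)

Section BlockTournament.
Variable bs : seq (nat * nat).
Hypothesis vbs : all valid bs.
Let n := btotal bs.

Definition block_rel (i j : nat) : bool :=
  [&& (i < n)%N, (j < n)%N & if (i < j)%N then bup bs i j else (j < i)%N && ~~ bup bs j i].

Definition block_mx : 'M[bool]_n := \matrix_(i, j) block_rel i j.

Lemma block_mxE (i j : 'I_n) : block_mx i j = block_rel i j.
Proof. by rewrite mxE. Qed.

Lemma block_tournament : tournament_mx block_mx.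
Proof.
apply/tournamentP; split=> [i|i j ij]; rewrite !block_mxE /block_rel !ltn_ord /=.
  by rewrite ltnn.
by move: ij; rewrite -(inj_eq val_inj) /=; case: ltngtP => //= _; rewrite negbK.
Qed.

Lemma block_row_sums : row_sums block_mx = bscores n bs.
Proof.
apply/rowP => i; rewrite row_sums_nat mxE.
have irr := nat_rel_irr block_tournament.
have tour := nat_rel_tournament block_tournament.
rewrite (score_excess tour irr) //; congr (_ + _).
rewrite -bexcessE // /excess.
have relE j k : (j < n)%N -> (k < n)%N -> (j < k)%N && nat_rel block_mx j k = bup bs j k.
  move=> hj hk; rewrite (nat_relE _ (Ordinal hj) (Ordinal hk)) block_mxE /block_rel /= hj hk /=.
  by case: ltnP => //= kj; apply/esym/negP => /(bup_lt vbs); lia.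
by congr (Posz _ - Posz _); apply: eq_cnt => j hj; rewrite relE.
Qed.

Let up_in (k : nat) := (\sum_(i < n | i < k) cnt n ((bup bs)^~ i))%N.
Let up_out (k : nat) := (\sum_(i < n | i < k) cnt n (bup bs i))%N.

Lemma block_partial_sums k : (k <= n)%N ->
  \sum_(i < n | (i < k)%N) bscores n bs 0 i = (up_out k)%:Z - (up_in k)%:Z + 'C(k, 2)%:Z.
Proof.
move=> kn; under eq_bigr do rewrite mxE -bexcessE // -/n.
rewrite big_split sumrB /=; congr (_ - _ + _).
- by rewrite -natz natr_sum; apply: eq_bigr => i _; rewrite natz.
- by rewrite -natz natr_sum; apply: eq_bigr => i _; rewrite natz.
rewrite -bin2_sum big_mkord -natz natr_sum -(big_ord_widen n (fun i => i%:Z) kn).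
by apply: eq_bigr => i _; rewrite natz.
Qed.

(** An upset that ends below [k] also starts below [k]. Through [block_partial_sums] this is the
    feasibility inequality. *)
Lemma up_in_le k : (up_in k <= up_out k)%N.
Proof.
rewrite /up_in /up_out; under eq_bigr do rewrite cntE.
rewrite exchange_big /= [leqRHS]big_mkcond; apply: leq_sum => j _ /=.
rewrite cntE; case: ltnP => jk; first by rewrite [leqLHS]big_mkcond leq_sum // => i _; case: ltnP.
by rewrite big1 // => i ik; apply/eqP; rewrite eqb0; apply/negP => /(bup_lt vbs); lia.
Qed.

Lemma up_in_total : up_in n = up_out n.
Proof.
rewrite /up_in /up_out; under eq_bigl do rewrite ltn_ord.
under [RHS]eq_bigl do rewrite ltn_ord.
under eq_bigr do rewrite cntE; under [RHS]eq_bigr do rewrite cntE.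
by rewrite exchange_big.
Qed.

Lemma block_feasible : feasible (bscores n bs).
Proof.
split.
- have step i : (i.+1 < n)%N -> bexcess bs i + i%:Z <= bexcess bs i.+1 + i.+1%:Z.
    by move=> hi; have := bexcess_drop vbs hi; lia.
  have mono d i : (i + d < n)%N -> bexcess bs i + i%:Z <= bexcess bs (i + d) + (i + d)%N%:Z.
    elim: d => [|d IH]; first by rewrite addn0.
    rewrite addnS => hi; apply: le_trans (step _ hi); apply: IH; exact: ltnW.
  move=> i j ij; rewrite !mxE -(subnKC ij); apply: mono.
  by rewrite subnKC.
- have := block_partial_sums (leqnn n); rewrite up_in_total subrr add0r => <-.
  by apply: eq_bigl => i; rewrite ltn_ord.
move=> k hk; have kn : (k <= n)%N by lia.
by rewrite block_partial_sums // lerDr subr_ge0 lez_nat up_in_le.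
Qed.

(** With [bpot] as potential, [gap_minimal] gives every other tournament with these scores strictly
    more upsets. *)
Lemma block_Umin : #|Umin (bscores n bs)| = 1%N.
Proof.
have gap B : B \in tournaments (bscores n bs) -> block_mx != B -> (upsets block_mx < upsets B)%N.
  rewrite inE => /andP[tB /eqP rB].
  apply: (gap_minimal (phi := fun i => bpot bs i) block_tournament tB).
    by rewrite rB block_row_sums.
  move=> i j ij; have := @bpot_gap bs i j vbs.
  by rewrite block_mxE /block_rel !ltn_ord ij /=; apply.
apply/eqP/cards1P; exists block_mx; apply/setP => B; rewrite in_set1.
apply/idP/eqP => [|->].
  rewrite inE => /andP[tB /forall_inP minB]; apply/eqP/negPn/negP => BA.
  have := gap B tB; rewrite eq_sym => /(_ BA); rewrite ltnNge minB //.
  by rewrite inE block_tournament block_row_sums eqxx.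
rewrite inE; apply/andP; split; first by rewrite inE block_tournament block_row_sums eqxx.
apply/forall_inP => D tD; have [<-//|AB] := eqVneq block_mx D.
by rewrite ltnW // gap.
Qed.

End BlockTournament.

(** * Counting block sequences *)

Lemma has_card_none (T : eqType) (P : T -> Prop) : (forall x, ~ P x) -> has_card P 0.
Proof. by move=> nP; exists [::]; split=> // x; split=> // /nP. Qed.

Lemma has_card_one (T : eqType) (P : T -> Prop) x : (forall y, P y <-> y = x) -> has_card P 1.
Proof.
by move=> Px; exists [:: x]; split=> // y; rewrite inE Px; split=> [/eqP|->].
Qed.

Lemma has_card_image (T U : eqType) (f : T -> U) (P : T -> Prop) (Q : U -> Prop) m :
    (forall x y, P x -> P y -> f x = f y -> x = y) ->
    (forall y, Q y <-> exists2 x, P x & y = f x) ->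
  has_card P m -> has_card Q m.
Proof.
move=> f_inj QE [s [us sP sm]]; exists (map f s); split; last by rewrite size_map.
  by rewrite map_inj_in_uniq // => x y /sP Px /sP Py; apply: f_inj.
move=> y; rewrite QE; split=> [/mapP[x /sP Px ->]|[x Px ->]]; first by exists x.
by apply/map_f/sP.
Qed.

Lemma has_card_disjoint (T : eqType) (P Q S : T -> Prop) p q :
    (forall x, P x -> Q x -> False) -> (forall x, S x <-> P x \/ Q x) ->
  has_card P p -> has_card Q q -> has_card S (p + q).
Proof.
move=> PQ SE [s [us sP <-]] [r [ur rQ <-]]; exists (s ++ r); split; last by rewrite size_cat.
  rewrite cat_uniq us ur andbT /=; apply/hasPn => x /rQ Qx.
  by apply/negP => /sP /PQ; apply.
move=> x; rewrite mem_cat SE; split=> [/orP[/sP|/rQ]|[/sP ->//|/rQ ->]]; rewrite ?orbT; by [left|right|].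
Qed.

(** The shift [i] expresses total length [n - i] without truncated subtraction, so nothing qualifies
    when [n < i]. *)
Definition blocks_of i n (bs : seq (nat * nat)) : bool := all valid bs && (btotal bs + i == n)%N.

Definition tall_blocks_of i n (bs : seq (nat * nat)) : bool :=
  blocks_of i n bs && (0 < (head (0, 0)%N bs).1)%N.

Lemma tall_nil i n : tall_blocks_of i n [::] = false.
Proof. exact: andbF. Qed.

Definition tight_blocks_of i n (bs : seq (nat * nat)) : bool :=
  tall_blocks_of i n bs && ((head (0, 0)%N bs).2 == 1)%N.

Definition grow_height (bs : seq (nat * nat)) :=
  if bs is (k, m) :: bs' then (k.+1, m) :: bs' else [::].
Definition grow_gap (bs : seq (nat * nat)) :=
  if bs is (k, m) :: bs' then (k, m.+1) :: bs' else [::].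

(* Holds the numbers of: block sequences of total length [n], [n-1], [n-2]; those of length [n]
   with [k > 0] in the first block; those of length [n], [n-1] with [k > 0] and [m = 1] there. *)
Fixpoint counts (n : nat) : nat * nat * nat * nat * nat * nat :=
  if n is n'.+1 then
    let: (a0, a1, a2, p, q0, q1) := counts n' in
    let q := (a2 + q1)%N in let p := (q + p)%N in
    ((a0 + p)%N, a0, a1, p, q, q0)
  else (1, 0, 0, 0, 0, 0)%N.

(** A first block [(1, 1)] is removed, which costs length 3; a higher one is lowered by one, which
    costs length 2. *)
Lemma tight_step n a2 q1 : has_card (blocks_of 2 n) a2 -> has_card (tight_blocks_of 1 n) q1 ->
  has_card (tight_blocks_of 0 n.+1) (a2 + q1).
Proof.
pose P bs := exists2 bs', blocks_of 2 n bs' & bs = (1, 1)%N :: bs'.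
pose Q bs := exists2 bs', tight_blocks_of 1 n bs' & bs = grow_height bs'.
move=> a2P q1P.
have cP : has_card P a2 by apply: (has_card_image (f := cons (1, 1)%N)) a2P => // x y _ _ [].
have cQ : has_card Q q1.
  apply: (has_card_image (f := grow_height)) q1P => // -[|[k m] bs] [|[k' m'] bs'] //=.
  by move=> _ _ [-> -> ->].
apply: has_card_disjoint cP cQ => [_ [x _ ->] [[|[k m] y]] // H [k0 _ _]|bs].
  by move: H; rewrite /tight_blocks_of /tall_blocks_of -k0 /= andbF.
split; last first.
  case=> [[bs' /andP[v t] ->]|[[|[k m] bs'] H ->]].
    by rewrite /tight_blocks_of /tall_blocks_of /blocks_of /= v /=; move: t; rewrite /btotal /= /bsize /=; lia.
    by move: H; rewrite /tight_blocks_of tall_nil.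
  by move: H; rewrite /tight_blocks_of /tall_blocks_of /blocks_of /= /valid /btotal /= /bsize /=; lia.
case: bs => [|[[|[|k]] m] bs]; rewrite /tight_blocks_of /tall_blocks_of ?andbF //.
  case/andP=> /andP[/andP[/andP[_ v] t] _] /eqP m1; have {}m1 : m = 1%N := m1; have {}v : all valid bs := v.
  left; exists bs; last by rewrite m1.
  by rewrite /blocks_of v; move: t; rewrite m1 /btotal /= /bsize /=; lia.
move=> H; right; exists ((k.+1, m) :: bs) => //.
by move: H; rewrite /tight_blocks_of /tall_blocks_of /blocks_of /= /valid /btotal /= /bsize /=; lia.
Qed.

(** Either the first block has a single zero, or one of its zeros can be removed. *)
Lemma tall_step n p q : has_card (tight_blocks_of 0 n.+1) q -> has_card (tall_blocks_of 0 n) p ->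
  has_card (tall_blocks_of 0 n.+1) (q + p).
Proof.
move=> cP pP; pose Q bs := exists2 bs', tall_blocks_of 0 n bs' & bs = grow_gap bs'.
have cQ : has_card Q p.
  apply: (has_card_image (f := grow_gap)) pP => // -[|[k m] bs] [|[k' m'] bs'] //=.
  by move=> _ _ [-> -> ->].
apply: has_card_disjoint cP cQ => [bs P [[|[k m] y] H E]|bs].
- by move: P; rewrite E.
- by move: P H; rewrite E /tight_blocks_of /tall_blocks_of /blocks_of /= /valid /=; lia.
split; last first.
  case=> [/andP[] //|[[|[k m] bs'] H ->]]; first by rewrite tall_nil in H.
  by move: H; rewrite /tall_blocks_of /blocks_of /= /valid /btotal /= /bsize /=; lia.
case: bs => [|[k [|[|m]]] bs] H.
- by move: H; rewrite /tall_blocks_of andbF.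
- by move: H; rewrite /tall_blocks_of /blocks_of /= /valid /=.
- by left; rewrite /tight_blocks_of H.
right; exists ((k, m.+1) :: bs) => //.
by move: H; rewrite /tall_blocks_of /blocks_of /= /valid /btotal /= /bsize /=; lia.
Qed.

(** A first block with [k = 0] is [(0, 1)] and can be removed. *)
Lemma blocks_step n a p : has_card (blocks_of 0 n) a -> has_card (tall_blocks_of 0 n.+1) p ->
  has_card (blocks_of 0 n.+1) (a + p).
Proof.
move=> aP cQ; pose P bs := exists2 bs', blocks_of 0 n bs' & bs = (0, 1)%N :: bs'.
have cP : has_card P a by apply: (has_card_image (f := cons (0, 1)%N)) aP => // x y _ _ [].
apply: has_card_disjoint cP cQ => [bs [x _ ->]|bs].
  by rewrite /tall_blocks_of andbF.
split; last first.
  case=> [[bs' H ->]|/andP[] //].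
  by move: H; rewrite /blocks_of /= /valid /btotal /= /bsize /=; lia.
case: bs => [|[[|k] m] bs] H; first by move: H; rewrite /blocks_of.
  have m1 : m = 1%N by move: H; rewrite /blocks_of /= /valid /=; lia.
  left; exists bs; last by rewrite m1.
  by move: H; rewrite m1 /blocks_of /= /valid /btotal /= /bsize /=; lia.
by right; rewrite /tall_blocks_of H.
Qed.

Lemma blocks_ofS (i n : nat) bs : blocks_of i.+1 n.+1 bs = blocks_of i n bs.
Proof. by rewrite /blocks_of addnS. Qed.

Lemma has_card_ext (T : eqType) (P Q : T -> bool) m : P =1 Q -> has_card P m -> has_card Q m.
Proof.
by move=> PQ [s [us sP sm]]; exists s; split=> // x; rewrite sP PQ.
Qed.

Lemma counts_card n : let: (a0, a1, a2, p, q0, q1) := counts n in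
  [/\ has_card (blocks_of 0 n) a0, has_card (blocks_of 1 n) a1 & has_card (blocks_of 2 n) a2] /\
  [/\ has_card (tall_blocks_of 0 n) p, has_card (tight_blocks_of 0 n) q0 &
      has_card (tight_blocks_of 1 n) q1].
Proof.
elim: n => [|n] /=.
  have nil bs : blocks_of 0 0 bs <-> bs = [::].
    split=> [|->//]; case: bs => //= -[k m] bs.
    by rewrite /blocks_of /= /valid /btotal /= /bsize /=; lia.
  split; split.
  - exact: has_card_one nil.
  - by apply: has_card_none => bs; rewrite /blocks_of addn1 andbF.
  - by apply: has_card_none => bs; rewrite /blocks_of addn2 andbF.
  - by apply: has_card_none => bs /andP[/nil ->].
  - by apply: has_card_none => bs /andP[/andP[/nil ->]].
  - by apply: has_card_none => bs; rewrite /tight_blocks_of /tall_blocks_of /blocks_of addn1 andbF.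
case: (counts n) => -[[[[a0 a1] a2] p] q0] q1 [[c0 c1 c2] [cp cq0 cq1]].
have cq := tight_step c2 cq1; have cp' := tall_step cq cp.
split; split=> //.
- exact: blocks_step.
- by apply: has_card_ext c0 => bs; rewrite blocks_ofS.
- by apply: has_card_ext c1 => bs; rewrite blocks_ofS.
by apply: has_card_ext cq0 => bs; rewrite /tight_blocks_of /tall_blocks_of blocks_ofS.
Qed.

Definition block_count n := (counts n).1.1.1.1.1.

(** In [counts], [q] is the second difference of the block counts, and its values at [n + 4] and
    [n + 2] differ by the block count at [n + 1]. *)
Lemma block_count_rec n :
  (block_count n.+4 + block_count n.+1 = 2 * block_count n.+3 + block_count n)%N.
Proof.
rewrite /block_count /=; case: (counts n) => -[[[[a0 a1] a2] p] q0] q1 /=; lia.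
Qed.

Lemma unique_min_count n :
  has_card (fun R : 'rV[int]_n => feasible R /\ #|Umin R| = 1%N) (block_count n).
Proof.
have c : has_card (blocks_of 0 n) (block_count n).
  by have := counts_card n; rewrite /block_count; case: (counts n) => -[[[[a0 a1] a2] p] q0] q1 [[]].
apply: (has_card_image (f := bscores n)) c => [bs bs'|R].
  rewrite /blocks_of !addn0 => /andP[vbs /eqP tbs] /andP[vbs' /eqP tbs'] E.
  apply: bexcess_inj => //; first by rewrite tbs'.
  rewrite tbs => i hi; have := congr1 (fun R : 'rV_n => R 0 (Ordinal hi)) E.
  by rewrite !mxE => /addIr.
split=> [[fR uR]|[bs /andP[vbs /eqP]]].
  have [bs [vbs tbs ->]] := unique_Umin_blocks fR uR.
  by exists bs => //; rewrite /blocks_of vbs addn0 tbs eqxx.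
by rewrite addn0 => tbs ->; subst n; split; [exact: block_feasible|exact: block_Umin].
Qed.

(** * Solving the recurrence *)

Section ClosedForm.
Variable C : numClosedFieldType.

Lemma linear_rec_unique (f g : nat -> C) :
    (forall n, f n.+4 = 2 * f n.+3 - f n.+1 + f n) ->
    (forall n, g n.+4 = 2 * g n.+3 - g n.+1 + g n) ->
    f 0%N = g 0%N -> f 1%N = g 1%N -> f 2%N = g 2%N -> f 3%N = g 3%N -> f =1 g.
Proof.
move=> fS gS f0 f1 f2 f3 n.
suff [] : [/\ f n = g n, f n.+1 = g n.+1, f n.+2 = g n.+2 & f n.+3 = g n.+3] by [].
by elim: n => [|n [e0 e1 e2 e3]]; split=> //; rewrite fS gS e0 e1 e3.
Qed.

Lemma exp_linear_rec (c x : C) n : x ^+ 4 = 2 * x ^+ 3 - x + 1 ->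
  c * x ^+ n.+4 = 2 * (c * x ^+ n.+3) - c * x ^+ n.+1 + c * x ^+ n.
Proof. by move=> x4; rewrite -[n.+4]addn4 -[n.+3]addn3 -[n.+1]addn1 !exprD x4; ring. Qed.

(** Here [x^2 - x = g] with [g = (1 + s) / 2] and [g^2 = g + 1]. Both signs of [s] and [r] are
    allowed, which covers all four characteristic roots. *)
Lemma quartic_root (s r : C) : s ^+ 2 = 5 -> r ^+ 2 = 2 * s + 3 ->
  ((1 + r) / 2) ^+ 4 = 2 * ((1 + r) / 2) ^+ 3 - (1 + r) / 2 + 1.
Proof.
move=> s2 r2; set x := (1 + r) / 2.
have x2 : x ^+ 2 = x + (1 + s) / 2.
  have -> : x ^+ 2 = (1 + 2 * r + r ^+ 2) / 4 by rewrite /x; field.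
  by rewrite r2 /x; field.
have g2 : ((1 + s) / 2) ^+ 2 = (1 + s) / 2 + 1.
  have -> : ((1 + s) / 2) ^+ 2 = (1 + 2 * s + s ^+ 2) / 4 by field.
  by rewrite s2; field.
have -> : x ^+ 3 = x * x ^+ 2 by ring.
have -> : x ^+ 4 = (x ^+ 2) ^+ 2 by ring.
have -> : x ^+ 2 = x + (1 + s) / 2 by [].
set g := (1 + s) / 2 in x2 g2 *.
transitivity (x ^+ 2 + 2 * g * x + g ^+ 2); first by ring.
rewrite g2; transitivity (2 * x ^+ 2 + 2 * g * x - x + 1); last by ring.
by rewrite x2; ring.
Qed.


(** Adding the terms for [r] and [- r] leaves only even powers of [r], hence expressions in [s].
    Adding the results for [s] and [- s] then gives 1, 1, 2, 4. *)
Lemma conjugate_pair_initial (s r : C) : s ^+ 2 = 5 -> r != 0 -> r ^+ 2 = 2 * s + 3 ->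
  let f n := (s + 1) / 4 * (1 / s - 1 / r) * ((1 - r) / 2) ^+ n
           + (s + 1) / 4 * (1 / s + 1 / r) * ((1 + r) / 2) ^+ n in
  [/\ f 0%N = (s + 5) / 10, f 1%N = (3 * s + 5) / 10,
      f 2%N = (3 * s + 5) / 5 & f 3%N = s + 2].
Proof.
move=> s2 r0 r2 f.
have s0 : s != 0 by apply/eqP => s0; move/eqP: s2; rewrite s0 expr0n eq_sym pnatr_eq0.
have sV : 1 / s = s / 5 by rewrite -s2; field.
(* Equality modulo [s^2 = 5]; the cofactor [k] is the quotient of [a - b] by [s^2 - 5]. *)
have red (a b k : C) : a - b = (s ^+ 2 - 5) * k -> a = b.
  by rewrite s2 subrr mul0r => /subr0_eq.
rewrite /f sV; split.
- by apply: (red _ _ (1 / 10)); field.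
- by apply: (red _ _ (1 / 20)); field.
- transitivity ((s + 1) / 4 * (s / 5 * ((1 + r ^+ 2) / 2) + 1)); first by field.
  by rewrite r2; apply: (red _ _ ((s + 3) / 20)); field.
transitivity ((s + 1) / 4 * (s / 5 * ((1 + 3 * r ^+ 2) / 4) + (3 + r ^+ 2) / 4)); first by field.
by rewrite r2; apply: (red _ _ ((3 * s + 13) / 40)); field.
Qed.

Lemma block_count_closed_form n :
  let s5 : C := sqrtC 5 in
  let p : C := sqrtC (2 * s5 + 3) in
  let q : C := sqrtC (2 * s5 - 3) in
  let c1 : C := (s5 + 1) / 4 * (1 / s5 - 1 / p) in
  let c2 : C := (s5 + 1) / 4 * (1 / s5 + 1 / p) in
  let c3 : C := (s5 - 1) / 4 * (1 / s5 - 'i / q) in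
  let c4 : C := (s5 - 1) / 4 * (1 / s5 + 'i / q) in
  (block_count n.+1)%:R = c1 * ((1 - p) / 2) ^+ n + c2 * ((1 + p) / 2) ^+ n
    + c3 * ((1 - 'i * q) / 2) ^+ n + c4 * ((1 + 'i * q) / 2) ^+ n.
Proof.
move=> s p q c1 c2 c3 c4.
have s2 : s ^+ 2 = 5 by rewrite sqrtCK.
have p2 : p ^+ 2 = 2 * s + 3 by rewrite sqrtCK.
have q2 : q ^+ 2 = 2 * s - 3 by rewrite sqrtCK.
have i2 : 'i ^+ 2 = -1 :> C by rewrite sqrCi.
have s2N : (- s) ^+ 2 = 5 by rewrite sqrrN.
have nat0 m : m.+1%:R != 0 :> C by rewrite pnatr_eq0.
have s0 : s != 0 by rewrite sqrtC_eq0 nat0.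
(* The nonzero product [(2s + 3)(2s - 3) = 11] shows that neither [p] nor [q] vanishes. *)
have pq : p ^+ 2 * q ^+ 2 = 11%:R.
  transitivity (4 * s ^+ 2 - 9); first by rewrite p2 q2; ring.
  by rewrite s2; ring.
have p0 : p != 0 by apply: contra_eq_neq pq => ->; rewrite expr0n mul0r eq_sym nat0.
have q0 : q != 0 by apply: contra_eq_neq pq => ->; rewrite expr0n mulr0 eq_sym nat0.
(* With this [r], the last two terms are the conjugate pair for [- s] in place of [s]. *)
pose r := 'i * q.
have r2 : r ^+ 2 = 2 * - s + 3 by rewrite exprMn i2 q2; ring.
have r0 : r != 0 by rewrite mulf_neq0 ?neq0Ci.
have rV : 1 / r = - ('i / q).
  have -> : 1 / r = - ('i ^+ 2) / r by rewrite i2 opprK.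
  by rewrite /r; field; rewrite q0 neq0Ci.
have c3E : c3 = (- s + 1) / 4 * (1 / - s - 1 / r) by rewrite rV /c3; field; rewrite s0 q0.
have c4E : c4 = (- s + 1) / 4 * (1 / - s + 1 / r) by rewrite rV /c4; field; rewrite s0 q0.
have pN : (- p) ^+ 2 = 2 * s + 3 by rewrite sqrrN.
have rN : (- r) ^+ 2 = 2 * - s + 3 by rewrite sqrrN.
have [P0 P1 P2 P3] := conjugate_pair_initial s2 p0 p2.
have [R0 R1 R2 R3] := conjugate_pair_initial s2N r0 r2.
rewrite -/r c3E c4E -addrA; apply: (linear_rec_unique (f := fun n => (block_count n.+1)%:R)
  (g := fun n => c1 * ((1 - p) / 2) ^+ n + c2 * ((1 + p) / 2) ^+ n + (_ * _ ^+ n + _ * _ ^+ n))).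
(* The recurrence over [nat] has no subtraction, so the subtracted term is first moved across. *)
- move=> m; apply: (addIr (block_count m.+2)%:R).
  by rewrite -natrD block_count_rec natrD natrM; ring.
- move=> m; rewrite !exp_linear_rec; first by ring.
  + exact: quartic_root s2 pN.
  + exact: quartic_root s2N r2.
  + exact: quartic_root s2N rN.
  + exact: quartic_root s2 p2.
- by rewrite P0 R0 /block_count /=; field.
- by rewrite P1 R1 /block_count /=; field.
- by rewrite P2 R2 /block_count /=; field.
- by rewrite P3 R3 /block_count /=; field.
Qed.

End ClosedForm.

Theorem theorem1p6 (C : numClosedFieldType) (n : nat) (hn : (1 <= n)%N) :
  exists m : nat,
    has_card (fun R : 'rV[int]_n => feasible R /\ #|Umin R| = 1%N) m /\
    let s5 : C := sqrtC 5 in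
    let p : C := sqrtC (2 * s5 + 3) in
    let q : C := sqrtC (2 * s5 - 3) in
    let c1 : C := (s5 + 1) / 4 * (1 / s5 - 1 / p) in
    let c2 : C := (s5 + 1) / 4 * (1 / s5 + 1 / p) in
    let c3 : C := (s5 - 1) / 4 * (1 / s5 - 'i / q) in
    let c4 : C := (s5 - 1) / 4 * (1 / s5 + 'i / q) in
    m%:R = c1 * ((1 - p) / 2) ^+ (n - 1)
         + c2 * ((1 + p) / 2) ^+ (n - 1)
         + c3 * ((1 - 'i * q) / 2) ^+ (n - 1)
         + c4 * ((1 + 'i * q) / 2) ^+ (n - 1) :> C.
Proof.
exists (block_count n); split; first exact: unique_min_count.
by case: n hn => // n _; rewrite subSS subn0; exact: block_count_closed_form.
Qed.
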